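(* Let $\Delta\subset\mathbb{C}$ be the open unit disk and let $f:\Delta\to\Delta$ be a holomorphic map such that $f(\zeta)=\zeta+o(\zeta-1)$ as $\zeta\to 1$ non-tangentially. Then either $f(\zeta)\equiv\zeta$, or $1$ is the Wolff point of $f$ and $$f^k\to 1,\qquad \liminf_{r\to 1^-}\frac{\mathrm{Re}\,(f(r)-r)}{(1-r)^3}>0,$$ where $f^k$ is the $k$-th iterate of $f$ and the convergence is uniform on compact subsets of $\Delta$.
   Context: Non-tangential limits at $1$: $g(\zeta)=o(h(\zeta))$ as $\zeta\to1$ non-tangentially means that for every $M>1$, $g(\zeta)/h(\zeta)\to 0$ as $\zeta\to 1$ within $\{\zeta\in\Delta: |\zeta-1|<M(1-|\zeta|)\}$. Wolff point: if a holomorphic self-map $f$ of $\Delta$ has no fixed point in $\Delta$, then there is a unique point $\sigma\in\partial\Delta$, called the Wolff point of $f$, such that $f(E(\sigma,R))\subset E(\sigma,R)$ for all $R>0$, where $E(\sigma,R)=\{\zeta\in\Delta: |\sigma-\zeta|^2/(1-|\zeta|^2)<R\}$. Saying that $1$ is the Wolff point of $f$ includes that $f$ has no fixed point in $\Delta$. In the limit, $r$ ranges over real numbers in $(0,1)$. *)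

(* Defs.v *)
(* Stdlib reals with Coquelicot's complex numbers. *)
From Stdlib Require Import Reals List.
From Coquelicot Require Import Coquelicot.
Open Scope R_scope.

Definition unit_disk (z : C) : Prop := Cmod z < 1.

(* A map of the disk is represented by a function on the whole of C whose
   values outside the disk are irrelevant; the disk being open, [ex_derive]
   over the field C at a point of the disk only depends on f inside it. *)
Definition holomorphic_self_map (f : C -> C) : Prop :=
  (forall z, unit_disk z -> unit_disk (f z)) /\
  (forall z, unit_disk z -> ex_derive (K := C_AbsRing) (V := C_NormedModule) f z).

(* Non-tangential approach region at the boundary point 1. *)
Definition stolz (M : R) (z : C) : Prop :=
  unit_disk z /\ Cmod (z - 1)%C < M * (1 - Cmod z).

Definition nontangential_little_o (g h : C -> C) : Prop :=
  forall M : R, 1 < M ->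
    filterlim (fun z : C => (g z / h z)%C)
      (within (stolz M) (locally (1 : C))) (locally (0 : C)).

Definition horodisk (sigma : C) (rho : R) (z : C) : Prop :=
  unit_disk z /\ (Cmod (sigma - z)%C) ^ 2 / (1 - (Cmod z) ^ 2) < rho.

Definition wolff_point (f : C -> C) (sigma : C) : Prop :=
  (forall z, unit_disk z -> f z <> z) /\
  Cmod sigma = 1 /\
  (forall rho : R, 0 < rho ->
     forall z, horodisk sigma rho z -> horodisk sigma rho (f z)).

Definition compact_set {T : UniformSpace} (K : T -> Prop) : Prop :=
  forall (I : Type) (U : I -> T -> Prop),
    (forall i, open (U i)) ->
    (forall x, K x -> exists i, U i x) ->
    exists l : list I, forall x, K x -> exists i, In i l /\ U i x.

Definition cvg_unif_on_compacts (u : nat -> C -> C) (D : C -> Prop) (g : C -> C)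
  : Prop :=
  forall K : C -> Prop, compact_set K -> (forall z, K z -> D z) ->
    forall eps : posreal,
      eventually (fun k => forall z, K z -> Cmod (u k z - g z)%C < eps).

(* Lower limit along a filter: the supremum over the sets P of F of the infimum
   of phi on P, in the extended reals (the value may be infinite). *)
Definition LimInf_filter {T : Type} (phi : T -> R) (F : (T -> Prop) -> Prop)
  : Rbar :=
  Rbar_lub (fun y : Rbar => exists P : T -> Prop,
    F P /\ y = Glb_Rbar (fun v : R => exists t, P t /\ v = phi t)).

(* Main.v *)
Require Import Defs.
From Stdlib Require Import Reals List Lra ClassicalEpsilon.
From Coquelicot Require Import Coquelicot.
Open Scope R_scope.

(** The displacement of f is measured in the right half-plane. With the Cayley
    transform c(z) = (1 + z) / (1 - z), put p(z) = c(f(z)) - c(z). Along the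
    radius the hypothesis says that the dilation of f at 1 is at most 1, so
    Julia's lemma ([Julia]) gives Re p >= 0 on the disk ([displacement_Re]).
    Everything then follows from Schwarz' lemma for maps into the half-plane,
      |p(z) - p(0)| <= |z| |p(z) + conj p(0)|      ([half_plane_Schwarz]),
    whose two consequences are Harnack's inequality
      Re p(z) >= Re p(0) (1 - |z|) / (1 + |z|)     ([Harnack])
    and the constancy of p when Re p(0) = 0.

    If p vanishes at a point, the inequality forces p(0) = 0, then p = 0 and f is
    the identity. Otherwise f has no fixed point, and Re p >= 0 is the invariance
    of the horodisks at 1: the point 1 is the Wolff point. With F = f(r), an exact
    computation gives
      Re (F - r) = |1 - F|^2 (Re p(r) / 2 + (1 - r) |p(r)|^2 / 4),
    and |1 - F| >= (1 - r) / 2 near 1, so that Re (F - r) / (1 - r)^3 is at least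
    (Re p(0) + |p(r)|^2) / 16 by Harnack: this is bounded below when Re p(0) > 0,
    and when Re p(0) = 0 because p is then a nonzero constant
    ([radial_displacement_bound]).

    For the iterates, let z_k be the orbit of 0. If p is constant, then
    c(z_k) = 1 + k p(0) tends to infinity. If Re p(0) > 0, the sequence
    J_k = Re c(z_k) increases with steps at least
    Re p(0) (1 - |z_k|) / (1 + |z_k|), while 1 / J_k also dominates
    (1 - |z_k|) / (1 + |z_k|); whether J_k converges or not, that quotient tends
    to 0, and inside the horodisk J >= 1 this means that z_k tends to 1. As f
    contracts the hyperbolic distance ([Schwarz_Pick]), the orbits of the points
    of a compact set stay at bounded hyperbolic distance from z_k and are dragged
    to 1 uniformly ([iterates_converge]).

    Schwarz' lemma rests on the maximum principle, which is built here from
    complex differentiability alone, with no continuity of the derivative.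
    Bisection proves Goursat's theorem on rectangles for a closed pair of real
    functions ([goursat]). In polar coordinates around a point the
    Cauchy-Riemann equations say that (Im h / r) dr + (Re h) dt is closed, and
    two sides of a rectangle over a full turn cancel: the circular means of Re h
    do not depend on the radius ([circle_mean_constant]). This only uses h on a
    punctured disk, so the mean value property holds at a point where h is
    merely continuous; the maximum principle therefore tolerates one exceptional
    point, and applies at once to the quotient g(z) / (z - w) of Schwarz' lemma. *)

(** * Bisection and Goursat's theorem on rectangles *)

Lemma nested_intervals : forall u v : nat -> R,
  (forall n, u n <= u (S n)) -> (forall n, v (S n) <= v n) ->
  (forall n, u n <= v n) ->
  exists x, forall n, u n <= x <= v n.
Proof.
  intros u v Hu Hv Huv.
  assert (Hum : forall n k, u n <= u (n + k)%nat).
  { intros n k; induction k as [|k IH].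
    - rewrite Nat.add_0_r; lra.
    - rewrite Nat.add_succ_r; specialize (Hu (n + k)%nat); lra. }
  assert (Hvm : forall n k, v (n + k)%nat <= v n).
  { intros n k; induction k as [|k IH].
    - rewrite Nat.add_0_r; lra.
    - rewrite Nat.add_succ_r; specialize (Hv (n + k)%nat); lra. }
  assert (Hall : forall n m, u n <= v m).
  { intros n m. specialize (Hum n m). specialize (Hvm m n).
    rewrite (Nat.add_comm m n) in Hvm. specialize (Huv (n + m)%nat). lra. }
  destruct (completeness (fun x => exists n, x = u n)) as [x [Hx1 Hx2]].
  - exists (v O). intros y [n ->]. apply Hall.
  - exists (u O). now exists O.
  - exists x. intros n; split.
    + apply Hx1. now exists n.
    + apply Hx2. intros y [m ->]. apply Hall.
Qed.

Lemma half_pow_small : forall l d, 0 < d -> exists n, l / 2 ^ n < d.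
Proof.
  intros l d Hd.
  destruct (Pow_x_infinity 2 ltac:(rewrite Rabs_pos_eq; lra) ((Rabs l + 1) / d)) as [n Hn].
  specialize (Hn n (le_n n)).
  assert (Hp : 0 < 2 ^ n) by (apply pow_lt; lra).
  rewrite (Rabs_pos_eq (2 ^ n)) in Hn by lra.
  exists n. apply Rmult_lt_reg_r with (2 ^ n); trivial.
  unfold Rdiv; rewrite Rmult_assoc, Rinv_l, Rmult_1_r by lra.
  assert (H := Rle_abs l).
  apply Rge_le in Hn. apply Rmult_le_compat_r with (r := d) in Hn; [|lra].
  unfold Rdiv in Hn; rewrite Rmult_assoc, Rinv_l, Rmult_1_r in Hn by lra. lra.
Qed.

(** The bisection principle: if P fails on a rectangle, it fails on one of its four
    quarters, hence on rectangles shrinking to a point, where P holds locally. *)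
Lemma rectangle_bisection : forall (P : R -> R -> R -> R -> Prop) a b c d,
  a <= b -> c <= d ->
  (forall a b c d, let m := (a + b) / 2 in let n := (c + d) / 2 in
     P a m c n -> P m b c n -> P a m n d -> P m b n d -> P a b c d) ->
  (forall x y, a <= x <= b -> c <= y <= d ->
     exists delta, 0 < delta /\
       forall a' b' c' d', a <= a' -> a' <= x <= b' -> b' <= b ->
         c <= c' -> c' <= y <= d' -> d' <= d ->
         b' - a' < delta -> d' - c' < delta -> P a' b' c' d') ->
  P a b c d.
Proof.
  intros P a b c d Hab Hcd Hsub Hloc.
  destruct (classic (P a b c d)) as [H|Hbad]; trivial. exfalso.
  set (bad := fun q : (R * R) * (R * R) =>
    ~ P (fst (fst q)) (snd (fst q)) (fst (snd q)) (snd (snd q))).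
  set (half := fun i j : R * R =>
    j = (fst i, (fst i + snd i) / 2) \/ j = ((fst i + snd i) / 2, snd i)).
  assert (step : forall q : {q | bad q},
    {q' : {q | bad q} | half (fst (proj1_sig q)) (fst (proj1_sig q')) /\
       half (snd (proj1_sig q)) (snd (proj1_sig q'))}).
  { intros [[[a1 b1] [c1 d1]] Hq]. apply constructive_indefinite_description.
    unfold bad in Hq; simpl in Hq.
    set (m := (a1 + b1) / 2). set (n := (c1 + d1) / 2).
    assert (E : forall a2 b2 c2 d2, half (a1, b1) (a2, b2) -> half (c1, d1) (c2, d2) ->
       ~ P a2 b2 c2 d2 ->
       exists q' : {q | bad q}, half (a1, b1) (fst (proj1_sig q')) /\
       half (c1, d1) (snd (proj1_sig q'))).
    { intros a2 b2 c2 d2 H1 H2 H3.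
      now exists (exist bad ((a2, b2), (c2, d2)) H3). }
    simpl.
    destruct (classic (P a1 m c1 n)) as [H1|H1];
      [|apply (E a1 m c1 n); trivial; now left].
    destruct (classic (P m b1 c1 n)) as [H2|H2];
      [|apply (E m b1 c1 n); trivial; [now right | now left]].
    destruct (classic (P a1 m n d1)) as [H3|H3];
      [|apply (E a1 m n d1); trivial; [now left | now right]].
    destruct (classic (P m b1 n d1)) as [H4|H4];
      [|apply (E m b1 n d1); trivial; now right].
    destruct Hq. now apply Hsub. }
  set (s := fun n => Nat.iter n (fun q => proj1_sig (step q))
                       (exist bad ((a, b), (c, d)) Hbad)).
  assert (Hs : forall n, half (fst (proj1_sig (s n))) (fst (proj1_sig (s (S n)))) /\
     half (snd (proj1_sig (s n))) (snd (proj1_sig (s (S n))))).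
  { intros n. exact (proj2_sig (step (s n))). }
  assert (side : forall (i : nat -> R * R) l r, l <= r -> i O = (l, r) ->
    (forall n, half (i n) (i (S n))) ->
    exists x, forall n, l <= fst (i n) <= x /\ x <= snd (i n) <= r /\
       snd (i n) - fst (i n) = (r - l) / 2 ^ n).
  { intros i l r Hlr H0 Hh.
    assert (Hw : forall n, snd (i n) - fst (i n) = (r - l) / 2 ^ n).
    { induction n as [|n IH].
      - rewrite H0; simpl; field.
      - simpl. replace ((r - l) / (2 * 2 ^ n)) with ((r - l) / 2 ^ n / 2)
          by (field; apply pow_nonzero; lra).
        destruct (Hh n) as [-> | ->]; simpl; lra. }
    assert (Hle : forall n, fst (i n) <= snd (i n)).
    { intros n. specialize (Hw n).
      assert (0 <= (r - l) / 2 ^ n); [|lra].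
      apply Rdiv_le_0_compat; [lra | apply pow_lt; lra]. }
    assert (Hi : forall n, fst (i n) <= fst (i (S n)) /\ snd (i (S n)) <= snd (i n)).
    { intros n. specialize (Hle n). destruct (Hh n) as [-> | ->]; simpl; lra. }
    destruct (nested_intervals (fun n => fst (i n)) (fun n => snd (i n))) as [x Hx];
      trivial; try (intros; apply Hi).
    exists x. intros n.
    assert (Hb : l <= fst (i n) /\ snd (i n) <= r).
    { induction n as [|n IH]; [rewrite H0; simpl; lra|].
      specialize (Hi n). lra. }
    specialize (Hx n). specialize (Hw n). simpl in Hx. lra. }
  destruct (side (fun n => fst (proj1_sig (s n))) a b Hab eq_refl) as [x Hx];
    [intros; apply Hs|].
  destruct (side (fun n => snd (proj1_sig (s n))) c d Hcd eq_refl) as [y Hy];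
    [intros; apply Hs|].
  assert (Hx0 := Hx O). assert (Hy0 := Hy O). simpl in Hx0, Hy0.
  destruct (Hloc x y) as [delta [Hd HP]]; [lra|lra|].
  destruct (half_pow_small (Rmax (b - a) (d - c)) delta Hd) as [n Hn].
  specialize (Hx n). specialize (Hy n).
  assert (Hp : 0 < / 2 ^ n) by (apply Rinv_0_lt_compat, pow_lt; lra).
  assert (H1 := Rmult_le_compat_r _ _ _ (Rlt_le _ _ Hp) (Rmax_l (b - a) (d - c))).
  assert (H2 := Rmult_le_compat_r _ _ _ (Rlt_le _ _ Hp) (Rmax_r (b - a) (d - c))).
  unfold Rdiv in *. simpl in Hx, Hy.
  apply (proj2_sig (s n)). apply HP; lra.
Qed.

(** Opposite sides are paired in one integral, so that an affine field gives constant
    integrands. *)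
Definition circulation (A B : R -> R -> R) (a b c d : R) : R :=
  RInt (fun x => A x c - A x d) a b + RInt (fun y => B b y - B a y) c d.

Lemma differentiable_continuous_1 : forall A x y l1 l2,
  differentiable_pt_lim A x y l1 l2 -> continuous (fun u => A u y) x.
Proof.
  intros A x y l1 l2 H.
  apply (ex_derive_continuous (V := R_NormedModule)).
  exists (l1 * 1 + l2 * 0). apply is_derive_Reals.
  apply (derivable_pt_lim_comp_2d A (fun t => t) (fun _ => y)); trivial.
  - apply derivable_pt_lim_id.
  - apply derivable_pt_lim_const.
Qed.

Lemma differentiable_continuous_2 : forall A x y l1 l2,
  differentiable_pt_lim A x y l1 l2 -> continuous (fun v => A x v) y.
Proof.
  intros A x y l1 l2 H.
  apply (ex_derive_continuous (V := R_NormedModule)).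
  exists (l1 * 0 + l2 * 1). apply is_derive_Reals.
  apply (derivable_pt_lim_comp_2d A (fun _ => x) (fun t => t)); trivial.
  - apply derivable_pt_lim_const.
  - apply derivable_pt_lim_id.
Qed.

(** The common value k is what closes the form A dx + B dy: A_y = k = B_x. *)
Definition closed_field_at (A B : R -> R -> R) (x y : R) : Prop :=
  exists p k q, differentiable_pt_lim A x y p k /\ differentiable_pt_lim B x y k q.

Lemma ex_RInt_horizontal : forall (A : R -> R -> R) a b c d,
  a <= b ->
  (forall x y, a <= x <= b -> (y = c \/ y = d) ->
     exists p q, differentiable_pt_lim A x y p q) ->
  ex_RInt (fun x => A x c - A x d) a b.
Proof.
  intros A a b c d Hab H.
  apply (ex_RInt_continuous (V := R_CompleteNormedModule)).
  rewrite Rmin_left, Rmax_right by trivial. intros z Hz.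
  destruct (H z c Hz (or_introl eq_refl)) as [p [q H1]].
  destruct (H z d Hz (or_intror eq_refl)) as [p' [q' H2]].
  apply (continuous_minus (V := R_NormedModule));
    eapply differentiable_continuous_1; eassumption.
Qed.

Lemma ex_RInt_vertical : forall (B : R -> R -> R) a b c d,
  c <= d ->
  (forall x y, c <= y <= d -> (x = a \/ x = b) ->
     exists p q, differentiable_pt_lim B x y p q) ->
  ex_RInt (fun y => B b y - B a y) c d.
Proof.
  intros A a b c d Hab H.
  apply (ex_RInt_continuous (V := R_CompleteNormedModule)).
  rewrite Rmin_left, Rmax_right by trivial. intros z Hz.
  destruct (H a z Hz (or_introl eq_refl)) as [p [q H1]].
  destruct (H b z Hz (or_intror eq_refl)) as [p' [q' H2]].
  apply (continuous_minus (V := R_NormedModule));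
    eapply differentiable_continuous_2; eassumption.
Qed.

Lemma circulation_bisect : forall A B a b c d,
  a <= b -> c <= d ->
  (forall x y, a <= x <= b -> c <= y <= d -> closed_field_at A B x y) ->
  let m := (a + b) / 2 in let n := (c + d) / 2 in
  circulation A B a b c d =
    circulation A B a m c n + circulation A B m b c n +
    (circulation A B a m n d + circulation A B m b n d).
Proof.
  intros A B a b c d Hab Hcd H m n.
  assert (Hm : a <= m <= b) by (unfold m; lra).
  assert (Hn : c <= n <= d) by (unfold n; lra).
  assert (HA : forall a' b' c' d', a <= a' -> a' <= b' -> b' <= b ->
    c <= c' <= d -> c <= d' <= d -> ex_RInt (fun x => A x c' - A x d') a' b').
  { intros. apply ex_RInt_horizontal; trivial. intros x y Hx [-> | ->].
    - destruct (H x c') as [p [k [q [H5 _]]]]; [lra|lra|eauto].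
    - destruct (H x d') as [p [k [q [H5 _]]]]; [lra|lra|eauto]. }
  assert (HB : forall a' b' c' d', a <= a' <= b -> a <= b' <= b ->
    c <= c' -> c' <= d' -> d' <= d -> ex_RInt (fun y => B b' y - B a' y) c' d').
  { intros. apply ex_RInt_vertical; trivial. intros x y Hx [-> | ->].
    - destruct (H a' y) as [p [k [q [_ H5]]]]; [lra|lra|eauto].
    - destruct (H b' y) as [p [k [q [_ H5]]]]; [lra|lra|eauto]. }
  unfold circulation.
  rewrite <- (RInt_Chasles (V := R_CompleteNormedModule) (fun x => A x c - A x d) a m b)
    by (apply HA; lra).
  rewrite <- (RInt_Chasles (V := R_CompleteNormedModule) (fun y => B b y - B a y) c n d)
    by (apply HB; lra).
  assert (EA : forall a' b', a <= a' -> a' <= b' -> b' <= b ->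
    RInt (fun x => A x c - A x d) a' b' =
    RInt (fun x => A x c - A x n) a' b' + RInt (fun x => A x n - A x d) a' b').
  { intros a' b' H1 H2 H3.
    rewrite <- (RInt_plus (V := R_CompleteNormedModule)) by (apply HA; lra).
    apply RInt_ext; intros; unfold plus; simpl; lra. }
  assert (EB : forall c' d', c <= c' -> c' <= d' -> d' <= d ->
    RInt (fun y => B b y - B a y) c' d' =
    RInt (fun y => B m y - B a y) c' d' + RInt (fun y => B b y - B m y) c' d').
  { intros c' d' H1 H2 H3.
    rewrite <- (RInt_plus (V := R_CompleteNormedModule)) by (apply HB; lra).
    apply RInt_ext; intros; unfold plus; simpl; lra. }
  rewrite !EA, !EB by lra. unfold plus; simpl. ring.
Qed.

(** Up to o(diameter) the field is affine near (x, y), and an affine field with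
    A_y = B_x has circulation 0. The bound is a multiple of the sum of the squared
    sides because that quantity is preserved by [circulation_bisect]: each of the
    four quarters carries a quarter of it. *)
Lemma circulation_small : forall A B x y eps,
  closed_field_at A B x y -> 0 < eps ->
  exists delta, 0 < delta /\
    forall a b c d, a <= x <= b -> c <= y <= d -> b - a < delta -> d - c < delta ->
      ex_RInt (fun x => A x c - A x d) a b ->
      ex_RInt (fun y => B b y - B a y) c d ->
      Rabs (circulation A B a b c d) <= eps * ((b - a) ^ 2 + (d - c) ^ 2).
Proof.
  intros A B x y eps [p [k [q [HA HB]]]] Heps.
  assert (He : 0 < eps / 4) by lra.
  destruct (HA (mkposreal _ He)) as [d1 H1].
  destruct (HB (mkposreal _ He)) as [d2 H2]. simpl in H1, H2.
  exists (Rmin d1 d2). split; [apply Rmin_case; apply cond_pos|].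
  intros a b c d Hx Hy Hba Hdc IA IB.
  assert (Hd1 := Rmin_l d1 d2). assert (Hd2 := Rmin_r d1 d2).
  set (s := Rmax (b - a) (d - c)).
  assert (Hs1 : b - a <= s) by apply Rmax_l.
  assert (Hs2 : d - c <= s) by apply Rmax_r.
  assert (Hss : s ^ 2 <= (b - a) ^ 2 + (d - c) ^ 2).
  { unfold s. apply Rmax_case; nra. }
  assert (EA : forall u v, a <= u <= b -> c <= v <= d ->
    Rabs (A u v - A x y - (p * (u - x) + k * (v - y))) <= eps / 4 * s).
  { intros u v Hu Hv.
    assert (U1 : Rabs (u - x) <= b - a) by (apply Rabs_le; lra).
    assert (V1 : Rabs (v - y) <= d - c) by (apply Rabs_le; lra).
    eapply Rle_trans; [apply H1; lra|]. apply Rmult_le_compat_l; [lra|].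
    apply Rmax_lub; lra. }
  assert (EB : forall u v, a <= u <= b -> c <= v <= d ->
    Rabs (B u v - B x y - (k * (u - x) + q * (v - y))) <= eps / 4 * s).
  { intros u v Hu Hv.
    assert (U1 : Rabs (u - x) <= b - a) by (apply Rabs_le; lra).
    assert (V1 : Rabs (v - y) <= d - c) by (apply Rabs_le; lra).
    eapply Rle_trans; [apply H2; lra|]. apply Rmult_le_compat_l; [lra|].
    apply Rmax_lub; lra. }
  (* the linear parts of the two integrals cancel because A_y = B_x *)
  assert (FA : Rabs (RInt (fun x => A x c - A x d + k * (d - c)) a b) <=
     (b - a) * (eps / 2 * s)).
  { apply abs_RInt_le_const; [lra| |].
    - apply (ex_RInt_plus (V := R_CompleteNormedModule)); trivial. apply ex_RInt_const.
    - intros t Ht. assert (G1 := EA t c Ht ltac:(lra)). assert (G2 := EA t d Ht ltac:(lra)).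
      apply Rabs_le_between in G1. apply Rabs_le_between in G2. apply Rabs_le. lra. }
  assert (FB : Rabs (RInt (fun y => B b y - B a y - k * (b - a)) c d) <=
     (d - c) * (eps / 2 * s)).
  { apply abs_RInt_le_const; [lra| |].
    - apply (ex_RInt_minus (V := R_CompleteNormedModule)); trivial. apply ex_RInt_const.
    - intros t Ht. assert (G1 := EB a t ltac:(lra) Ht). assert (G2 := EB b t ltac:(lra) Ht).
      apply Rabs_le_between in G1. apply Rabs_le_between in G2. apply Rabs_le. lra. }
  rewrite (RInt_plus (V := R_CompleteNormedModule)), RInt_const in FA;
    [|trivial|apply ex_RInt_const].
  rewrite (RInt_minus (V := R_CompleteNormedModule)), RInt_const in FB;
    [|trivial|apply ex_RInt_const].
  unfold circulation. unfold plus, minus, opp, scal, mult in FA, FB; simpl in FA, FB.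
  unfold plus, mult in FA, FB; simpl in FA, FB.
  apply Rabs_le_between in FA. apply Rabs_le_between in FB.
  assert (0 <= s) by lra.
  assert (Z1 : (b - a) * (eps / 2 * s) <= s * (eps / 2 * s))
    by (apply Rmult_le_compat_r; trivial; apply Rmult_le_pos; lra).
  assert (Z2 : (d - c) * (eps / 2 * s) <= s * (eps / 2 * s))
    by (apply Rmult_le_compat_r; trivial; apply Rmult_le_pos; lra).
  assert (Z3 : eps * s ^ 2 <= eps * ((b - a) ^ 2 + (d - c) ^ 2))
    by (apply Rmult_le_compat_l; lra).
  apply Rabs_le. lra.
Qed.

(** Additivity spreads the bound of [circulation_small], with an arbitrary eps, from
    small rectangles to the whole one. *)
Lemma goursat : forall A B a b c d,
  a <= b -> c <= d ->
  (forall x y, a <= x <= b -> c <= y <= d -> closed_field_at A B x y) ->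
  circulation A B a b c d = 0.
Proof.
  intros A B a b c d Hab Hcd H.
  assert (HI : forall a' b' c' d', a <= a' -> a' <= b' -> b' <= b ->
    c <= c' -> c' <= d' -> d' <= d ->
    ex_RInt (fun x => A x c' - A x d') a' b' /\ ex_RInt (fun y => B b' y - B a' y) c' d').
  { intros a' b' c' d' H1 H2 H3 H4 H5 H6; split.
    - apply ex_RInt_horizontal; trivial.
      intros x y Hx Hy.
      destruct (H x y) as [p [k [q [G _]]]]; [lra|destruct Hy; subst; lra|eauto].
    - apply ex_RInt_vertical; trivial.
      intros x y Hx Hy.
      destruct (H x y) as [p [k [q [_ G]]]]; [destruct Hy; subst; lra|lra|eauto]. }
  assert (Heps : forall eps, 0 < eps ->
    Rabs (circulation A B a b c d) <= eps * ((b - a) ^ 2 + (d - c) ^ 2)).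
  { intros eps Heps.
    assert (HP := rectangle_bisection (fun a' b' c' d' =>
      a <= a' -> a' <= b' -> b' <= b -> c <= c' -> c' <= d' -> d' <= d ->
      Rabs (circulation A B a' b' c' d') <= eps * ((b' - a') ^ 2 + (d' - c') ^ 2))
      a b c d Hab Hcd).
    apply HP; try lra; clear HP.
    - intros a' b' c' d' m n P1 P2 P3 P4 L1 L2 L3 L4 L5 L6.
      rewrite circulation_bisect by (trivial; intros; apply H; lra).
      fold m n.
      assert (Hm : a' <= m <= b') by (unfold m; lra).
      assert (Hn : c' <= n <= d') by (unfold n; lra).
      assert (Q1 := P1 ltac:(lra) ltac:(lra) ltac:(lra) ltac:(lra) ltac:(lra) ltac:(lra)).
      assert (Q2 := P2 ltac:(lra) ltac:(lra) ltac:(lra) ltac:(lra) ltac:(lra) ltac:(lra)).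
      assert (Q3 := P3 ltac:(lra) ltac:(lra) ltac:(lra) ltac:(lra) ltac:(lra) ltac:(lra)).
      assert (Q4 := P4 ltac:(lra) ltac:(lra) ltac:(lra) ltac:(lra) ltac:(lra) ltac:(lra)).
      eapply Rle_trans; [apply Rabs_triang|].
      eapply Rle_trans; [apply Rplus_le_compat; apply Rabs_triang|].
      replace (eps * ((b' - a') ^ 2 + (d' - c') ^ 2)) with
       (eps * ((m - a') ^ 2 + (n - c') ^ 2) + eps * ((b' - m) ^ 2 + (n - c') ^ 2) +
       (eps * ((m - a') ^ 2 + (d' - n) ^ 2) + eps * ((b' - m) ^ 2 + (d' - n) ^ 2)))
       by (unfold m, n; field).
      lra.
    - intros x y Hx Hy.
      destruct (circulation_small A B x y eps (H x y Hx Hy) Heps) as [delta [Hd HS]].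
      exists delta; split; trivial.
      intros a' b' c' d' G1 G2 G3 G4 G5 G6 G7 G8 L1 L2 L3 L4 L5 L6.
      destruct (HI a' b' c' d' L1 L2 L3 L4 L5 L6) as [I1 I2].
      exact (HS a' b' c' d' G2 G5 G7 G8 I1 I2). }
  destruct (Req_dec (circulation A B a b c d) 0) as [E|E]; trivial.
  apply Rabs_pos_lt in E.
  set (K := (b - a) ^ 2 + (d - c) ^ 2) in *.
  assert (HK : 0 <= K) by (unfold K; nra).
  assert (Hpos : 0 < Rabs (circulation A B a b c d) / (2 * (K + 1)))
    by (apply Rdiv_lt_0_compat; lra).
  specialize (Heps _ Hpos).
  assert (Rabs (circulation A B a b c d) / (2 * (K + 1)) * K <=
     Rabs (circulation A B a b c d) / 2); [|lra].
  apply Rle_trans with (Rabs (circulation A B a b c d) / (2 * (K + 1)) * (K + 1)).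
  - apply Rmult_le_compat_l; lra.
  - right; field; lra.
Qed.

(** * Complex continuity and differentiability *)

(** Continuity for the modulus; the product topology of the plane gives the same
    notion. *)
Definition C_continuous (f : C -> C) (z : C) : Prop :=
  forall eps, 0 < eps -> exists delta, 0 < delta /\
    forall w, Cmod (w - z)%C < delta -> Cmod (f w - f z)%C < eps.

(** Caratheodory's form of complex differentiability: the slope function q extends
    continuously to z. Closure properties become algebra on slopes, and the
    removable singularity of (f w - f z) / (w - z) is part of the definition. *)
Definition C_differentiable (f : C -> C) (z : C) : Prop :=
  exists q : C -> C, C_continuous q z /\ forall w, f w = (f z + q w * (w - z))%C.

Lemma C_continuous_const : forall c z, C_continuous (fun _ => c) z.
Proof.
  intros c z eps H; exists 1; split; [lra|]; intros w _.
  replace (c - c)%C with (RtoC 0) by ring. now rewrite Cmod_0.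
Qed.

Lemma C_continuous_id : forall z, C_continuous (fun w => w) z.
Proof. intros z eps H; now exists eps. Qed.

Lemma C_continuous_plus : forall f g z, C_continuous f z -> C_continuous g z ->
  C_continuous (fun w => f w + g w)%C z.
Proof.
  intros f g z Hf Hg eps He.
  destruct (Hf (eps / 2) ltac:(lra)) as [d1 [P1 H1]].
  destruct (Hg (eps / 2) ltac:(lra)) as [d2 [P2 H2]].
  exists (Rmin d1 d2); split; [now apply Rmin_case|]. intros w Hw.
  assert (A := H1 w (Rlt_le_trans _ _ _ Hw (Rmin_l _ _))).
  assert (B := H2 w (Rlt_le_trans _ _ _ Hw (Rmin_r _ _))).
  replace (f w + g w - (f z + g z))%C with ((f w - f z) + (g w - g z))%C by ring.
  assert (T := Cmod_triangle (f w - f z) (g w - g z)). lra.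
Qed.

Lemma C_continuous_mult : forall f g z, C_continuous f z -> C_continuous g z ->
  C_continuous (fun w => f w * g w)%C z.
Proof.
  intros f g z Hf Hg eps He.
  set (M := Cmod (f z) + Cmod (g z) + 1).
  assert (F0 := Cmod_ge_0 (f z)). assert (G0 := Cmod_ge_0 (g z)).
  set (e := Rmin 1 (eps / (2 * M))).
  assert (HM : 0 < M) by (unfold M; lra).
  assert (Pe : 0 < e).
  { unfold e; apply Rmin_case; [lra|]. apply Rdiv_lt_0_compat; lra. }
  assert (E1 : e <= 1) by apply Rmin_l.
  assert (E2 : e * M <= eps / 2).
  { apply Rle_trans with (eps / (2 * M) * M).
    - apply Rmult_le_compat_r; [lra|apply Rmin_r].
    - right; field; lra. }
  destruct (Hf e Pe) as [d1 [P1 H1]]. destruct (Hg e Pe) as [d2 [P2 H2]].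
  exists (Rmin d1 d2); split; [now apply Rmin_case|]. intros w Hw.
  assert (A := H1 w (Rlt_le_trans _ _ _ Hw (Rmin_l _ _))).
  assert (B := H2 w (Rlt_le_trans _ _ _ Hw (Rmin_r _ _))).
  replace (f w * g w - f z * g z)%C with
    ((f w - f z) * (g w - g z) + ((f w - f z) * g z + f z * (g w - g z)))%C by ring.
  eapply Rle_lt_trans; [apply Cmod_triangle|].
  eapply Rle_lt_trans; [apply Rplus_le_compat_l, Cmod_triangle|].
  rewrite !Cmod_mult.
  assert (A0 := Cmod_ge_0 (f w - f z)). assert (B0 := Cmod_ge_0 (g w - g z)).
  assert (X1 : Cmod (f w - f z) * Cmod (g w - g z) <= e * 1)
    by (apply Rmult_le_compat; lra).
  assert (X2 : Cmod (f w - f z) * Cmod (g z) <= e * Cmod (g z))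
    by (apply Rmult_le_compat_r; lra).
  assert (X3 : Cmod (f z) * Cmod (g w - g z) <= Cmod (f z) * e)
    by (apply Rmult_le_compat_l; lra).
  unfold M in E2. lra.
Qed.

Lemma C_continuous_inv : forall f z, C_continuous f z -> f z <> 0 ->
  C_continuous (fun w => / f w)%C z.
Proof.
  intros f z Hf Hz eps He.
  assert (P : 0 < Cmod (f z)) by now apply Cmod_gt_0.
  set (m := Cmod (f z)) in *.
  assert (Pe : 0 < Rmin (m / 2) (eps * m ^ 2 / 2)).
  { apply Rmin_case; [lra|]. assert (0 < m ^ 2) by nra. nra. }
  destruct (Hf _ Pe) as [d [Pd H]]. exists d; split; trivial. intros w Hw.
  specialize (H w Hw).
  assert (A := Rlt_le_trans _ _ _ H (Rmin_l _ _)).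
  assert (B := Rlt_le_trans _ _ _ H (Rmin_r _ _)).
  assert (L : m / 2 < Cmod (f w)).
  { assert (T := Cmod_triangle (f w) (- (f w - f z))).
    replace (f w + - (f w - f z))%C with (f z) in T by ring.
    rewrite Cmod_opp in T. fold m in T. lra. }
  assert (Hw0 : f w <> 0) by (apply Cmod_gt_0; lra).
  replace (/ f w - / f z)%C with (- (f w - f z) * (/ f w * / f z))%C by (field; now split).
  rewrite !Cmod_mult, Cmod_opp, !Cmod_inv by trivial. fold m.
  apply Rlt_le_trans with (eps * m ^ 2 / 2 * (/ Cmod (f w) * / m)).
  - apply Rmult_lt_compat_r; trivial.
    apply Rmult_lt_0_compat; apply Rinv_0_lt_compat; lra.
  - replace (eps * m ^ 2 / 2 * (/ Cmod (f w) * / m)) with (eps * (m / 2 * / Cmod (f w)))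
      by (field; lra).
    rewrite <- (Rmult_1_r eps) at 2. apply Rmult_le_compat_l; [lra|].
    apply Rmult_le_reg_r with (Cmod (f w)); [lra|].
    rewrite Rmult_assoc, Rinv_l; lra.
Qed.

Lemma C_differentiable_continuous : forall f z, C_differentiable f z -> C_continuous f z.
Proof.
  intros f z [q [Hq E]].
  assert (H : C_continuous (fun w => f z + q w * (w - z))%C z).
  { apply C_continuous_plus; [apply C_continuous_const|].
    apply C_continuous_mult; trivial.
    apply (C_continuous_plus (fun w => w) (fun _ => (- z)%C));
      [apply C_continuous_id|apply C_continuous_const]. }
  intros eps He. destruct (H eps He) as [d [Pd Hd]]. exists d; split; trivial.
  intros w Hw. specialize (Hd w Hw). rewrite (E w).
  replace (f z + q w * (w - z) - f z)%C
    with (f z + q w * (w - z) - (f z + q z * (z - z)))%C by ring. exact Hd.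
Qed.

Lemma C_differentiable_const : forall c z, C_differentiable (fun _ => c) z.
Proof.
  intros c z; exists (fun _ => 0); split; [apply C_continuous_const|]; intros; ring.
Qed.

Lemma C_differentiable_id : forall z, C_differentiable (fun w => w) z.
Proof.
  intros z; exists (fun _ => 1); split; [apply C_continuous_const|]; intros; ring.
Qed.

Lemma C_differentiable_plus : forall f g z, C_differentiable f z -> C_differentiable g z ->
  C_differentiable (fun w => f w + g w)%C z.
Proof.
  intros f g z [p [Hp Ep]] [q [Hq Eq]]. exists (fun w => p w + q w)%C; split.
  - now apply C_continuous_plus.
  - intros w; rewrite (Ep w), (Eq w); ring.
Qed.

Lemma C_differentiable_mult : forall f g z, C_differentiable f z -> C_differentiable g z ->
  C_differentiable (fun w => f w * g w)%C z.
Proof.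
  intros f g z Hf Hg. assert (Cg := C_differentiable_continuous _ _ Hg).
  destruct Hf as [p [Hp Ep]]. destruct Hg as [q [Hq Eq]].
  exists (fun w => p w * g w + f z * q w)%C; split.
  - apply C_continuous_plus; apply C_continuous_mult; trivial; apply C_continuous_const.
  - intros w; rewrite (Ep w), (Eq w); ring.
Qed.

(** Differentiability is local, which is needed for formulas that hold only where
    a denominator does not vanish. *)
Lemma C_differentiable_near : forall f g z delta, 0 < delta ->
  (forall w, Cmod (w - z)%C < delta -> f w = g w) ->
  C_differentiable f z -> C_differentiable g z.
Proof.
  intros f g z delta Pd H [q [Hq E]].
  assert (Z : f z = g z).
  { apply H. replace (z - z)%C with (RtoC 0) by ring. now rewrite Cmod_0. }
  exists (fun w => if Rlt_dec (Cmod (w - z)%C) delta then q w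
                   else ((g w - g z) / (w - z))%C); split.
  - intros eps He. destruct (Hq eps He) as [d [P1 H1]].
    exists (Rmin d delta); split; [now apply Rmin_case|]. intros w Hw.
    assert (W1 := Rlt_le_trans _ _ _ Hw (Rmin_l _ _)).
    assert (W2 := Rlt_le_trans _ _ _ Hw (Rmin_r _ _)).
    destruct (Rlt_dec (Cmod (w - z)%C) delta) as [_|N]; [|contradiction].
    destruct (Rlt_dec (Cmod (z - z)%C) delta) as [_|N]; [now apply H1|].
    destruct N. replace (z - z)%C with (RtoC 0) by ring. now rewrite Cmod_0.
  - intros w. destruct (Rlt_dec (Cmod (w - z)%C) delta) as [L|N].
    + rewrite <- Z, <- H by trivial. apply E.
    + field. intros K. apply N. rewrite K. now rewrite Cmod_0.
Qed.

Lemma C_differentiable_inv : forall f z, C_differentiable f z -> f z <> 0 ->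
  C_differentiable (fun w => / f w)%C z.
Proof.
  intros f z Hf Hz. assert (Cf := C_differentiable_continuous _ _ Hf).
  destruct (Cf (Cmod (f z))) as [d [Pd Hd]]; [now apply Cmod_gt_0|].
  assert (NZ : forall w, Cmod (w - z)%C < d -> f w <> 0).
  { intros w Hw K. specialize (Hd w Hw). rewrite K in Hd.
    replace (0 - f z)%C with (- f z)%C in Hd by ring. rewrite Cmod_opp in Hd. lra. }
  destruct Hf as [q [Hq E]].
  apply C_differentiable_near with (f := fun w =>
    (/ f z + (- q w * (/ f w * / f z)) * (w - z))%C) (delta := d); trivial.
  - intros w Hw. specialize (NZ w Hw).
    transitivity (/ f z - (f w - f z) * (/ f w * / f z))%C.
    + rewrite (E w) at 2. ring.
    + field; now split.
  - exists (fun w => - q w * (/ f w * / f z))%C; split.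
    + apply C_continuous_mult.
      * assert (H : C_continuous (fun w => (- (1)) * q w)%C z)
          by (apply C_continuous_mult; trivial; apply C_continuous_const).
        intros eps He. destruct (H eps He) as [d' [P' H']]. exists d'; split; trivial.
        intros w Hw. replace (- q w - - q z)%C with (- (1) * q w - - (1) * q z)%C by ring.
        now apply H'.
      * apply C_continuous_mult; [|apply C_continuous_const].
        now apply C_continuous_inv.
    + intros w; ring.
Qed.

Lemma C_differentiable_minus : forall f g z, C_differentiable f z -> C_differentiable g z ->
  C_differentiable (fun w => f w - g w)%C z.
Proof.
  intros f g z Hf Hg. apply C_differentiable_plus; trivial.
  destruct Hg as [q [Hq E]]. exists (fun w => (- (1)) * q w)%C; split.
  - apply C_continuous_mult; trivial; apply C_continuous_const.
  - intros w; rewrite (E w); ring.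
Qed.

Lemma C_differentiable_div : forall f g z, C_differentiable f z -> C_differentiable g z ->
  g z <> 0 -> C_differentiable (fun w => f w / g w)%C z.
Proof.
  intros f g z Hf Hg H. apply C_differentiable_mult; trivial.
  now apply C_differentiable_inv.
Qed.

Lemma ex_derive_C_differentiable : forall (f : C -> C) (z : C),
  ex_derive (K := C_AbsRing) (V := C_NormedModule) f z -> C_differentiable f z.
Proof.
  intros f z [l [_ H]].
  specialize (H z (fun P HP => HP)).
  exists (fun w => if excluded_middle_informative (w = z) then l
                   else ((f w - f z) / (w - z))%C); split.
  - intros eps He. assert (He2 : 0 < eps / 2) by lra.
    specialize (H (mkposreal _ He2)).
    destruct H as [d Hd].
    exists d; split; [apply cond_pos|]. intros w Hw.
    destruct (excluded_middle_informative (z = z)) as [_|N]; [|now destruct N].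
    destruct (excluded_middle_informative (w = z)) as [E|N].
    + apply Rle_lt_trans with (Cmod 0); [|now rewrite Cmod_0].
      right; f_equal. exact (Cplus_opp_r l).
    + specialize (Hd w Hw). simpl in Hd.
      change (Cmod (f w - f z - (w - z) * l)%C <= eps / 2 * Cmod (w - z)%C) in Hd.
      assert (N' : (w - z)%C <> 0).
      { intros K. apply N. replace w with ((w - z) + z)%C by ring. rewrite K. ring. }
      assert (P : 0 < Cmod (w - z)%C) by now apply Cmod_gt_0.
      replace ((f w - f z) / (w - z) - l)%C with ((f w - f z - (w - z) * l) / (w - z))%C
        by now field.
      rewrite Cmod_div by trivial.
      apply Rmult_lt_reg_r with (Cmod (w - z)%C); trivial.
      unfold Rdiv; rewrite Rmult_assoc, Rinv_l, Rmult_1_r by lra.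
      eapply Rle_lt_trans; [apply Hd|]. apply Rmult_lt_compat_r; lra.
  - intros w. destruct (excluded_middle_informative (w = z)) as [->|N].
    + ring.
    + field. intros K. apply N. replace w with ((w - z) + z)%C by ring. rewrite K. ring.
Qed.

(** * The mean value property *)

Lemma sqrt2_le_2 : sqrt 2 <= 2.
Proof.
  apply Rle_trans with (sqrt (2 * 2)).
  - apply sqrt_le_1_alt; lra.
  - rewrite sqrt_square; lra.
Qed.

Lemma Cmod_le_add_sub : forall w z : C, Cmod w <= Cmod z + Cmod (w - z)%C.
Proof.
  intros w z. replace w with (z + (w - z))%C at 1 by ring. apply Cmod_triangle.
Qed.

Lemma im_le_Cmod : forall c : C, Rabs (Im c) <= Cmod c.
Proof.
  intros c. eapply Rle_trans; [apply Rmax_r|apply (Rmax_Cmod c)].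
Qed.

Lemma Cauchy_Riemann : forall h x y, C_differentiable h (x, y) ->
  exists a b, differentiable_pt_lim (fun u v => Re (h (u, v))) x y a (- b) /\
              differentiable_pt_lim (fun u v => Im (h (u, v))) x y b a.
Proof.
  intros h x y [q [Hq E]].
  exists (Re (q (x, y))), (Im (q (x, y))).
  assert (Hc : forall eps : posreal, locally_2d (fun u v =>
     Cmod (h (u, v) - h (x, y) - q (x, y) * ((u, v) - (x, y)))%C
       <= eps * Rmax (Rabs (u - x)) (Rabs (v - y))) x y).
  { intros eps. assert (Pe : 0 < eps / 2) by (assert (P := cond_pos eps); lra).
    destruct (Hq _ Pe) as [d [Pd Hd]].
    assert (Pd2 : 0 < d / 2) by lra.
    exists (mkposreal _ Pd2); simpl. intros u v Hu Hv.
    assert (B : Cmod ((u, v) - (x, y))%C <= 2 * Rmax (Rabs (u - x)) (Rabs (v - y))).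
    { eapply Rle_trans; [apply Cmod_2Rmax|]. simpl.
      apply Rmult_le_compat_r.
      - eapply Rle_trans; [apply Rabs_pos|apply Rmax_l].
      - apply sqrt2_le_2. }
    assert (B2 : Cmod ((u, v) - (x, y))%C < d).
    { eapply Rle_lt_trans; [apply B|].
      assert (Rmax (Rabs (u - x)) (Rabs (v - y)) < d / 2) by now apply Rmax_lub_lt.
      lra. }
    specialize (Hd _ B2).
    replace (h (u, v) - h (x, y) - q (x, y) * ((u, v) - (x, y)))%C
      with ((q (u, v) - q (x, y)) * ((u, v) - (x, y)))%C
      by (rewrite (E (u, v)); ring).
    rewrite Cmod_mult.
    apply Rle_trans with (eps / 2 * (2 * Rmax (Rabs (u - x)) (Rabs (v - y)))).
    - apply Rmult_le_compat; [apply Cmod_ge_0|apply Cmod_ge_0|apply Rlt_le, Hd|apply B].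
    - right; field. }
  split; intros eps; destruct (Hc eps) as [d Hd]; exists d; intros u v Hu Hv;
    (eapply Rle_trans; [|apply (Hd u v Hu Hv)]).
  - eapply Rle_trans; [|apply re_le_Cmod].
    right; f_equal; unfold Re, Im; simpl; ring.
  - eapply Rle_trans; [|apply im_le_Cmod].
    right; f_equal; unfold Re, Im; simpl; ring.
Qed.

Definition polar (z0 : C) (r t : R) : C := (Re z0 + r * cos t, Im z0 + r * sin t).

Lemma Cmod_polar : forall z0 r t, 0 <= r -> Cmod (polar z0 r t - z0)%C = r.
Proof.
  intros z0 r t Hr. unfold Cmod, polar; simpl.
  replace ((Re z0 + r * cos t + - fst z0) * ((Re z0 + r * cos t + - fst z0) * 1) +
    (Im z0 + r * sin t + - snd z0) * ((Im z0 + r * sin t + - snd z0) * 1))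
    with (r * r * ((sin t)² + (cos t)²)) by (unfold Re, Im, Rsqr; ring).
  rewrite sin2_cos2, Rmult_1_r. now apply sqrt_square.
Qed.

Lemma differentiable_pt_lim_mult : forall f g x y f1 f2 g1 g2,
  differentiable_pt_lim f x y f1 f2 -> differentiable_pt_lim g x y g1 g2 ->
  differentiable_pt_lim (fun u v => f u v * g u v) x y
    (g x y * f1 + f x y * g1) (g x y * f2 + f x y * g2).
Proof.
  intros f g x y f1 f2 g1 g2 Hf Hg.
  apply (differentiable_pt_lim_comp (fun u v => u * v) f g); trivial.
  intros eps. exists eps. intros u v Hu Hv.
  set (p := f x y) in *. set (q := g x y) in *.
  replace (u * v - p * q - (q * (u - p) + p * (v - q))) with ((u - p) * (v - q)) by ring.
  rewrite Rabs_mult. apply Rmult_le_compat; try apply Rabs_pos; [lra|apply Rmax_r].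
Qed.

Lemma differentiable_pt_lim_plus : forall f g x y f1 f2 g1 g2,
  differentiable_pt_lim f x y f1 f2 -> differentiable_pt_lim g x y g1 g2 ->
  differentiable_pt_lim (fun u v => f u v + g u v) x y (f1 + g1) (f2 + g2).
Proof.
  intros f g x y f1 f2 g1 g2 Hf Hg.
  replace (f1 + g1) with (1 * f1 + 1 * g1) by ring.
  replace (f2 + g2) with (1 * f2 + 1 * g2) by ring.
  apply (differentiable_pt_lim_comp (fun u v => u + v) f g); trivial.
  intros eps. exists (mkposreal _ Rlt_0_1). intros u v _ _.
  match goal with |- Rabs ?e <= _ => replace e with 0 by ring end.
  rewrite Rabs_R0. apply Rmult_le_pos; [apply Rlt_le, cond_pos|].
  eapply Rle_trans; [apply Rabs_pos|apply Rmax_l].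
Qed.

Lemma differentiable_pt_lim_snd : forall f x y l, derivable_pt_lim f y l ->
  differentiable_pt_lim (fun _ v => f v) x y 0 l.
Proof.
  intros f x y l H.
  replace 0 with (l * 0 + 0 * 0) by ring. replace l with (l * 1 + 0 * 1) at 2 by ring.
  apply (differentiable_pt_lim_comp (fun u _ => f u) (fun _ v => v) (fun _ v => v)).
  - now apply differentiable_pt_lim_proj1_0.
  - intros eps. exists (mkposreal _ Rlt_0_1). intros u v _ _.
    match goal with |- Rabs ?e <= _ => replace e with 0 by ring end.
    rewrite Rabs_R0. apply Rmult_le_pos; [apply Rlt_le, cond_pos|].
    eapply Rle_trans; [apply Rabs_pos|apply Rmax_l].
  - intros eps. exists (mkposreal _ Rlt_0_1). intros u v _ _.
    match goal with |- Rabs ?e <= _ => replace e with 0 by ring end.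
    rewrite Rabs_R0. apply Rmult_le_pos; [apply Rlt_le, cond_pos|].
    eapply Rle_trans; [apply Rabs_pos|apply Rmax_l].
Qed.

Lemma differentiable_polar : forall c f r t l, derivable_pt_lim f t l ->
  differentiable_pt_lim (fun s u => c + s * f u) r t (f t) (r * l).
Proof.
  intros c f r t l H.
  replace (f t) with (0 + (f t * 1 + r * 0)) at 1 by ring.
  replace (r * l) with (0 + (f t * 0 + r * l)) by ring.
  apply (differentiable_pt_lim_plus (fun _ _ => c)).
  - apply (differentiable_pt_lim_proj1_0 (fun _ => c)). apply derivable_pt_lim_const.
  - apply (differentiable_pt_lim_mult (fun s _ => s) (fun _ u => f u)).
    + apply (differentiable_pt_lim_proj1_0 (fun s => s)). apply derivable_pt_lim_id.
    + now apply differentiable_pt_lim_snd.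
Qed.

(** The Cauchy-Riemann equations in polar coordinates: dRe h / dr = (1 / r) dIm h / dt. *)
Lemma polar_closed_field : forall h z0 r t, 0 < r ->
  C_differentiable h (polar z0 r t) ->
  closed_field_at (fun s u => Im (h (polar z0 s u)) * / s)
                  (fun s u => Re (h (polar z0 s u))) r t.
Proof.
  intros h z0 r t Hr H.
  destruct (Cauchy_Riemann h _ _ H) as [a [b [HU HV]]].
  assert (DX := differentiable_polar (Re z0) cos r t _ (derivable_pt_lim_cos t)).
  assert (DY := differentiable_polar (Im z0) sin r t _ (derivable_pt_lim_sin t)).
  assert (KU := differentiable_pt_lim_comp _ _ _ _ _ _ _ _ _ _ _ HU DX DY).
  assert (KV := differentiable_pt_lim_comp _ _ _ _ _ _ _ _ _ _ _ HV DX DY).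
  assert (DI : differentiable_pt_lim (fun s _ => / s) r t (- 1 / r ^ 2) 0).
  { apply (differentiable_pt_lim_proj1_0 (fun s => / s)).
    apply is_derive_Reals. apply (is_derive_inv (fun s => s)); [|lra].
    apply (is_derive_id (K := R_AbsRing)). }
  assert (KW := differentiable_pt_lim_mult _ _ _ _ _ _ _ _ KV DI).
  cbv beta in KW, KU.
  eexists. exists (a * cos t + - b * sin t). eexists. split.
  - match type of KW with differentiable_pt_lim _ _ _ _ ?k =>
      replace k with (a * cos t + - b * sin t) in KW by (field; lra) end.
    exact KW.
  - exact KU.
Qed.

(** Goursat on the rectangle [r1, r2] x [0, 2 PI]: the two sides t = 0 and t = 2 PI
    carry the same values and cancel, leaving the difference of the circular means. *)
Lemma circle_mean_constant : forall h z0 rho r1 r2,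
  (forall z, 0 < Cmod (z - z0)%C < rho -> C_differentiable h z) ->
  0 < r1 -> r1 <= r2 -> r2 < rho ->
  RInt (fun t => Re (h (polar z0 r1 t))) 0 (2 * PI) =
  RInt (fun t => Re (h (polar z0 r2 t))) 0 (2 * PI).
Proof.
  intros h z0 rho r1 r2 H H1 H12 H2.
  assert (P := PI_RGT_0).
  assert (HF : forall r t, r1 <= r <= r2 -> 0 <= t <= 2 * PI ->
    closed_field_at (fun s u => Im (h (polar z0 s u)) * / s)
                  (fun s u => Re (h (polar z0 s u))) r t).
  { intros r t Hr _. apply polar_closed_field; [lra|]. apply H.
    rewrite Cmod_polar; lra. }
  assert (G := goursat _ _ r1 r2 0 (2 * PI) H12 ltac:(lra) HF).
  unfold circulation in G.
  rewrite (RInt_ext _ (fun _ => 0)) in G.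
  2:{ intros r _. unfold polar. rewrite cos_0, sin_0, cos_2PI, sin_2PI.
      exact (Rminus_diag_eq _ _ eq_refl). }
  rewrite RInt_const in G.
  assert (EX : forall r, r1 <= r <= r2 ->
     ex_RInt (fun t => Re (h (polar z0 r t))) 0 (2 * PI)).
  { intros r Hr. apply (ex_RInt_continuous (V := R_CompleteNormedModule)).
    rewrite Rmin_left, Rmax_right by lra. intros t Ht.
    destruct (HF r t Hr Ht) as [p [k [q [_ D]]]].
    apply (differentiable_continuous_2 _ _ _ _ _ D). }
  rewrite (RInt_minus (V := R_CompleteNormedModule)) in G; try (apply EX; lra).
  unfold minus, plus, opp, scal in G; simpl in G. unfold mult in G; simpl in G. lra.
Qed.

Lemma ex_RInt_circle : forall h z0 rho r,
  (forall z, 0 < Cmod (z - z0)%C < rho -> C_differentiable h z) ->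
  0 < r < rho -> ex_RInt (fun t => Re (h (polar z0 r t))) 0 (2 * PI).
Proof.
  intros h z0 rho r H Hr. apply (ex_RInt_continuous (V := R_CompleteNormedModule)).
  intros t _.
  destruct (polar_closed_field h z0 r t) as [p [k [q [_ D]]]]; [lra| |].
  - apply H. rewrite Cmod_polar; lra.
  - apply (differentiable_continuous_2 _ _ _ _ _ D).
Qed.

(** Continuity at z0 suffices there: the means over small circles converge to the
    value at the centre. *)
Lemma mean_value_property : forall h z0 rho r,
  C_continuous h z0 ->
  (forall z, 0 < Cmod (z - z0)%C < rho -> C_differentiable h z) ->
  0 < r < rho ->
  RInt (fun t => Re (h (polar z0 r t))) 0 (2 * PI) = 2 * PI * Re (h z0).
Proof.
  intros h z0 rho r Hc H Hr.
  assert (P := PI_RGT_0).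
  apply cond_eq. intros eps He.
  assert (Pe : 0 < eps / (4 * PI)) by (apply Rdiv_lt_0_compat; lra).
  destruct (Hc _ Pe) as [d [Pd Hd]].
  set (s := Rmin (d / 2) r).
  assert (Ps : 0 < s) by (apply Rmin_case; lra).
  assert (S1 : s <= d / 2) by apply Rmin_l. assert (S2 : s <= r) by apply Rmin_r.
  rewrite <- (circle_mean_constant h z0 rho s r) by (trivial; lra).
  assert (EX := ex_RInt_circle h z0 rho s H ltac:(lra)).
  replace (2 * PI * Re (h z0)) with (RInt (fun _ => Re (h z0)) 0 (2 * PI)).
  2:{ rewrite RInt_const. unfold scal; simpl; unfold mult; simpl; ring. }
  assert (B : Rabs (RInt (fun t => Re (h (polar z0 s t)) - Re (h z0)) 0 (2 * PI))
      <= (2 * PI - 0) * (eps / (4 * PI))).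
  { apply abs_RInt_le_const; [lra| |].
    - apply (ex_RInt_minus (V := R_CompleteNormedModule)); trivial. apply ex_RInt_const.
    - intros t _. eapply Rle_trans; [|apply Rlt_le, (Hd (polar z0 s t))].
      + eapply Rle_trans; [|apply re_le_Cmod]. right; f_equal.
      + rewrite Cmod_polar; lra. }
  rewrite (RInt_minus (V := R_CompleteNormedModule)) in B; trivial; [|apply ex_RInt_const].
  unfold minus, plus, opp in B; simpl in B.
  replace ((2 * PI - 0) * (eps / (4 * PI))) with (eps / 2) in B by (field; lra).
  unfold Rminus. lra.
Qed.

(** * The maximum principle *)

(** Without a maximum every value is exceeded by another one, and by continuity a
    single point of the disk exceeds all values nearby. Bisection globalizes this:
    some point exceeds all values, including its own. *)
Lemma max_attained_on_disk : forall (g : C -> R) r, 0 <= r ->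
  (forall z, Cmod z <= r -> forall eps, 0 < eps -> exists delta, 0 < delta /\
     forall w, Cmod w <= r -> Cmod (w - z)%C < delta -> Rabs (g w - g z) < eps) ->
  exists z0, Cmod z0 <= r /\ forall z, Cmod z <= r -> g z <= g z0.
Proof.
  intros g r Hr Hc. apply NNPP. intros Hno.
  assert (Hup : forall z, Cmod z <= r -> exists w, Cmod w <= r /\ g z < g w).
  { intros z Hz. apply NNPP. intros N. apply Hno. exists z; split; trivial.
    intros w Hw. apply Rnot_lt_le. intros L. apply N. now exists w. }
  assert (HP := rectangle_bisection (fun a b c d =>
    exists w, Cmod w <= r /\ forall z, a <= Re z <= b -> c <= Im z <= d -> Cmod z <= r ->
      g z < g w) (- r) r (- r) r ltac:(lra) ltac:(lra)).
  destruct HP as [w [Hw HA]].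
  - intros a b c d m n [w1 [W1 H1]] [w2 [W2 H2]] [w3 [W3 H3]] [w4 [W4 H4]].
    assert (J : forall u v, Cmod u <= r -> Cmod v <= r ->
      exists w, Cmod w <= r /\ g u <= g w /\ g v <= g w).
    { intros u v Hu Hv. destruct (Rle_dec (g u) (g v)) as [L|L].
      - exists v; repeat split; trivial; lra.
      - exists u; repeat split; trivial; lra. }
    destruct (J w1 w2 W1 W2) as [u [U [U1 U2]]]. destruct (J w3 w4 W3 W4) as [v [V [V1 V2]]].
    destruct (J u v U V) as [w [W [X1 X2]]].
    exists w; split; trivial. intros z Hre Him Hz.
    destruct (Rle_dec (Re z) m); destruct (Rle_dec (Im z) n).
    + specialize (H1 z). lra.
    + specialize (H3 z). lra.
    + specialize (H2 z). lra.
    + specialize (H4 z). lra.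
  - intros x y _ _.
    destruct (Rle_dec (Cmod (x, y)) r) as [Hz|Hz].
    + destruct (Hup _ Hz) as [w [Hw Lw]].
      destruct (Hc _ Hz (g w - g (x, y))) as [d [Pd Hd]]; [lra|].
      exists (d / 2); split; [lra|].
      intros a b c e _ Hx _ _ Hy _ L1 L2. exists w; split; trivial.
      intros z Hre Him Hzr. specialize (Hd z Hzr).
      apply Rabs_lt_between in Hd; [lra|].
      assert (S2 := sqrt2_le_2).
      eapply Rle_lt_trans; [apply Cmod_2Rmax|].
      destruct z as [z1 z2]; simpl in Hre, Him |- *.
      apply Rle_lt_trans with (2 * Rmax (Rabs (z1 + - x)) (Rabs (z2 + - y))).
      * apply Rmult_le_compat_r; trivial. eapply Rle_trans; [apply Rabs_pos|apply Rmax_l].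
      * assert (Rmax (Rabs (z1 + - x)) (Rabs (z2 + - y)) < d / 2); [|lra].
        apply Rmax_lub_lt; apply Rabs_def1; lra.
    + assert (Pd : 0 < (Cmod (x, y) - r) / 2) by lra.
      exists ((Cmod (x, y) - r) / 2); split; trivial.
      intros a b c e _ Hx _ _ Hy _ L1 L2. exists 0; split; [now rewrite Cmod_0|].
      intros z Hre Him Hzr. exfalso.
      assert (S2 := sqrt2_le_2).
      assert (T := Cmod_le_add_sub (x, y) z).
      assert (B := Cmod_2Rmax ((x, y) - z)%C).
      destruct z as [z1 z2]; simpl in Hre, Him, B.
      assert (M : Rmax (Rabs (x + - z1)) (Rabs (y + - z2)) < (Cmod (x, y) - r) / 2).
      { apply Rmax_lub_lt; apply Rabs_def1; lra. }
      assert (M0 : 0 <= Rmax (Rabs (x + - z1)) (Rabs (y + - z2))).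
      { eapply Rle_trans; [apply Rabs_pos|apply Rmax_l]. }
      assert (sqrt 2 * Rmax (Rabs (x + - z1)) (Rabs (y + - z2)) <=
         2 * Rmax (Rabs (x + - z1)) (Rabs (y + - z2))) by (apply Rmult_le_compat_r; trivial).
      lra.
  - assert (R1 := re_le_Cmod w). assert (R2 := im_le_Cmod w).
    apply Rabs_le_between in R1. apply Rabs_le_between in R2.
    specialize (HA w). lra.
Qed.

Lemma sqr_le_reg : forall a b, 0 <= b -> a ^ 2 <= b ^ 2 -> a <= b.
Proof.
  intros a b Hb H. apply Rsqr_incr_0_var; trivial. unfold Rsqr. lra.
Qed.

Lemma RInt_trigonometric : forall k a b,
  is_RInt (fun t => k + (a * cos t + b * sin t)) 0 (2 * PI) (2 * PI * k).
Proof.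
  intros k a b.
  replace (2 * PI * k) with (minus (k * (2 * PI) + (a * sin (2 * PI) - b * cos (2 * PI)))
     (k * 0 + (a * sin 0 - b * cos 0))).
  - apply (is_RInt_derive (fun t => k * t + (a * sin t - b * cos t))).
    + intros t _. auto_derive; trivial. ring.
    + intros t _. apply (ex_derive_continuous (V := R_NormedModule)). auto_derive; trivial.
  - rewrite sin_2PI, cos_2PI, sin_0, cos_0. unfold minus, plus, opp; simpl. ring.
Qed.

(** Adding e |z|^2 makes the mean over a circle strictly exceed the value at the
    centre, so the perturbed function has its maximum on the boundary. The point w
    is an exceptional point at which h is only known to be continuous. *)
Lemma maximum_principle_Re : forall h w r m,
  0 < r -> C_continuous h w ->
  (forall z, Cmod z <= r -> z <> w -> C_differentiable h z) ->
  (forall z, Cmod z = r -> Re (h z) <= m) ->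
  forall z, Cmod z <= r -> Re (h z) <= m.
Proof.
  intros h w r m Hr Hw Hd Hm z Hz.
  assert (Hc : forall z, Cmod z <= r -> C_continuous h z).
  { intros x Hx. destruct (classic (x = w)) as [->|N]; trivial.
    apply C_differentiable_continuous; auto. }
  apply le_epsilon. intros eps He.
  set (e := eps / r ^ 2).
  assert (Pr : 0 < r ^ 2) by (apply pow_lt; lra).
  assert (Pe : 0 < e) by (apply Rdiv_lt_0_compat; lra).
  assert (Er : e * r ^ 2 = eps) by (unfold e; field; lra).
  (* the strictly subharmonic perturbation cannot peak inside *)
  destruct (max_attained_on_disk (fun z => Re (h z) + e * Cmod z ^ 2) r) as [z0 [Hz0 Hmax]].
  - lra.
  - intros x Hx d Pd.
    destruct (Hc x Hx (d / 2) ltac:(lra)) as [d1 [P1 H1]].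
    assert (P2 : 0 < d / (4 * e * r)) by (apply Rdiv_lt_0_compat; [lra|nra]).
    (* |e |y|^2 - e |x|^2| <= 2 e r ||y| - |x||, which should be at most d / 2 *)
    exists (Rmin d1 (d / (4 * e * r))). split; [now apply Rmin_case|].
    intros y Hy Hyx.
    assert (A := H1 y (Rlt_le_trans _ _ _ Hyx (Rmin_l _ _))).
    assert (B := Rlt_le_trans _ _ _ Hyx (Rmin_r _ _)).
    assert (A' := re_le_Cmod (h y - h x)%C).
    assert (C1 := Cmod_le_add_sub y x). assert (C2 := Cmod_le_add_sub x y).
    replace (x - y)%C with (- (y - x))%C in C2 by ring. rewrite Cmod_opp in C2.
    assert (X0 := Cmod_ge_0 x). assert (Y0 := Cmod_ge_0 y).
    replace (Re (h y) + e * Cmod y ^ 2 - (Re (h x) + e * Cmod x ^ 2)) with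
      (Re (h y - h x)%C + e * ((Cmod y + Cmod x) * (Cmod y - Cmod x)))
      by (unfold Re; simpl; ring).
    eapply Rle_lt_trans; [apply Rabs_triang|].
    rewrite Rabs_mult, (Rabs_pos_eq e), Rabs_mult, (Rabs_pos_eq (Cmod y + Cmod x)) by lra.
    assert (Q : Rabs (Cmod y - Cmod x) <= d / (4 * e * r)) by (apply Rabs_le; lra).
    assert (Q2 : (Cmod y + Cmod x) * Rabs (Cmod y - Cmod x) <= (2 * r) * (d / (4 * e * r))).
    { apply Rmult_le_compat; trivial; try lra. apply Rabs_pos. }
    apply Rmult_le_compat_l with (r := e) in Q2; [|lra].
    replace (e * (2 * r * (d / (4 * e * r)))) with (d / 2) in Q2 by (field; split; lra).
    lra.
  - destruct (Rle_lt_or_eq_dec _ _ Hz0) as [L|E].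
    + exfalso.
      (* a disk around z0 inside |z| < r that avoids w, unless z0 = w *)
      assert (Hrho : exists rho, 0 < rho /\
        forall x, 0 < Cmod (x - z0)%C < rho -> Cmod x <= r /\ x <> w).
      { destruct (classic (z0 = w)) as [E|N].
        - exists (r - Cmod z0). split; [lra|]. intros x Hx.
          assert (T := Cmod_le_add_sub x z0). split; [lra|].
          intros ->. rewrite E in Hx. replace (w - w)%C with (RtoC 0) in Hx by ring.
          rewrite Cmod_0 in Hx. lra.
        - exists (Rmin (r - Cmod z0) (Cmod (w - z0)%C)). split.
          + apply Rmin_case; [lra|]. apply Cmod_gt_0. intros K. apply N.
            replace w with ((w - z0) + z0)%C by ring. rewrite K. ring.
          + intros x [Hx1 Hx2].
            assert (T := Cmod_le_add_sub x z0).
            assert (K1 := Rlt_le_trans _ _ _ Hx2 (Rmin_l _ _)).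
            assert (K2 := Rlt_le_trans _ _ _ Hx2 (Rmin_r _ _)).
            split; [lra|]. intros ->. lra. }
      destruct Hrho as [rho [Prho HR]].
      assert (HD : forall x, 0 < Cmod (x - z0)%C < rho -> C_differentiable h x).
      { intros x Hx. destruct (HR x Hx). now apply Hd. }
      assert (MV := mean_value_property h z0 rho (rho / 2) (Hc z0 Hz0) HD ltac:(lra)).
      set (s := rho / 2) in *.
      assert (Ps : 0 < s) by (unfold s; lra).
      assert (P := PI_RGT_0).
      assert (IT := RInt_trigonometric (Re (h z0) - e * s ^ 2)
         (- (2 * e * s * Re z0)) (- (2 * e * s * Im z0))).
      assert (LE : RInt (fun t => Re (h (polar z0 s t))) 0 (2 * PI) <=
        RInt (fun t => (Re (h z0) - e * s ^ 2) +
          (- (2 * e * s * Re z0) * cos t + - (2 * e * s * Im z0) * sin t)) 0 (2 * PI)).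
      { apply RInt_le; [lra| | |].
        - apply (ex_RInt_circle h z0 rho s HD). unfold s; lra.
        - eexists; exact IT.
        - intros t _. assert (Hp := Cmod_polar z0 s t ltac:(lra)).
          destruct (HR (polar z0 s t)) as [Hpr _]; [rewrite Hp; unfold s; lra|].
          specialize (Hmax _ Hpr). rewrite !Cmod2_alt in Hmax.
          assert (ES : (cos t) ^ 2 + (sin t) ^ 2 = 1).
          { rewrite <- (sin2_cos2 t). unfold Rsqr. ring. }
          change (Re (polar z0 s t)) with (Re z0 + s * cos t) in Hmax.
          change (Im (polar z0 s t)) with (Im z0 + s * sin t) in Hmax.
          replace ((Re z0 + s * cos t) ^ 2 + (Im z0 + s * sin t) ^ 2) with
            (Re z0 ^ 2 + Im z0 ^ 2 + 2 * s * (Re z0 * cos t + Im z0 * sin t) +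
             s ^ 2 * ((cos t) ^ 2 + (sin t) ^ 2)) in Hmax by ring.
          rewrite ES in Hmax. lra. }
      rewrite MV, (is_RInt_unique _ _ _ _ IT) in LE.
      assert (0 < e * s ^ 2) by (apply Rmult_lt_0_compat; [|apply pow_lt]; lra).
      assert (2 * PI * (e * s ^ 2) <= 0) by lra. nra.
    + specialize (Hmax z Hz). specialize (Hm z0 E). rewrite E in Hmax.
      assert (0 <= e * Cmod z ^ 2) by (apply Rmult_le_pos; [lra|apply pow2_ge_0]).
      lra.
Qed.

(** A rotation makes the value at a given point real, which reduces the claim to
    the real part. *)
Lemma maximum_modulus : forall h w r m,
  0 < r -> C_continuous h w ->
  (forall z, Cmod z <= r -> z <> w -> C_differentiable h z) ->
  (forall z, Cmod z = r -> Cmod (h z) <= m) ->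
  forall z, Cmod z <= r -> Cmod (h z) <= m.
Proof.
  intros h w r m Hr Hw Hd Hm z Hz.
  destruct (classic (h z = 0)) as [E|N].
  - rewrite E, Cmod_0. apply Rle_trans with (Cmod (h r)); [apply Cmod_ge_0|].
    apply Hm. rewrite Cmod_R. apply Rabs_pos_eq; lra.
  - assert (Pz : 0 < Cmod (h z)) by now apply Cmod_gt_0.
    set (u := (Cconj (h z) * RtoC (/ Cmod (h z)))%C).
    assert (Hu : Cmod u = 1).
    { unfold u. rewrite Cmod_mult, Cmod_conj, Cmod_R, Rabs_pos_eq.
      - apply Rinv_r; lra.
      - apply Rlt_le, Rinv_0_lt_compat; lra. }
    assert (E : Re (u * h z)%C = Cmod (h z)).
    { replace (u * h z)%C with ((h z * Cconj (h z)) * RtoC (/ Cmod (h z)))%C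
        by (unfold u; ring).
      rewrite <- Cmod2_conj, <- RtoC_mult. unfold RtoC, Re; simpl.
      field; lra. }
    rewrite <- E.
    apply (maximum_principle_Re (fun x => u * h x)%C w r m); trivial.
    + apply C_continuous_mult; trivial. apply C_continuous_const.
    + intros x Hx Nx. apply C_differentiable_mult; [apply C_differentiable_const|auto].
    + intros x Hx. eapply Rle_trans; [eapply Rle_trans; [apply Rle_abs|apply re_le_Cmod]|].
      rewrite Cmod_mult, Hu, Rmult_1_l. now apply Hm.
Qed.

(** * The lemmas of Schwarz and Pick *)

(** Equivalently, 1 - |(z - w) / (1 - conj w z)|^2 is
    (1 - |w|^2) (1 - |z|^2) / |1 - conj w z|^2. *)
Lemma disk_automorphism_identity : forall w z : C,
  Cmod (1 - Cconj w * z)%C ^ 2 = Cmod (z - w)%C ^ 2 + (1 - Cmod w ^ 2) * (1 - Cmod z ^ 2).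
Proof.
  intros [a b] [c d]. rewrite !Cmod2_alt. unfold Re, Im; simpl. ring.
Qed.

Lemma Cminus_neq_0 : forall z w : C, z <> w -> (z - w)%C <> 0.
Proof.
  intros z w N K. apply N. replace z with ((z - w) + w)%C by ring. rewrite K. ring.
Qed.

(** Schwarz' lemma centred at w. The maximum principle applies to the quotient of g
    by the disk automorphism (z - w) / (1 - conj w z), of modulus nearly 1 on circles
    |z| = r near the boundary; w is the exceptional point, and the continuous slope
    of g at w supplies the value there. *)
Lemma Schwarz_lemma : forall g w,
  Cmod w < 1 ->
  (forall z, Cmod z < 1 -> C_differentiable g z) ->
  (forall z, Cmod z < 1 -> Cmod (g z) <= 1) ->
  g w = 0 ->
  forall z, Cmod z < 1 -> Cmod (g z) * Cmod (1 - Cconj w * z)%C <= Cmod (z - w)%C.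
Proof.
  intros g w Hw Hd Hb Hgw z Hz.
  destruct (Hd w Hw) as [q [Hq E]].
  assert (Eg : forall x, g x = (q x * (x - w))%C) by (intros x; rewrite (E x), Hgw; ring).
  set (h := fun x => (q x * (1 - Cconj w * x))%C).
  assert (W0 := Cmod_ge_0 w). assert (Z0 := Cmod_ge_0 z).
  assert (Hlin : forall x, C_differentiable (fun x => (1 - Cconj w * x)%C) x).
  { intros x. apply C_differentiable_minus; [apply C_differentiable_const|].
    apply C_differentiable_mult; [apply C_differentiable_const|apply C_differentiable_id]. }
  assert (Hh : Cmod (h z) <= 1).
  { apply le_epsilon. intros eta Heta.
    (* the circle |x| = 1 - t must enclose z and keep distance (1 - |w|) / 2 from w;
       the last bound makes 2 t / |x - w|^2 at most eta *)
    set (t := Rmin ((1 - Cmod z) / 2) (Rmin ((1 - Cmod w) / 2) (eta * (1 - Cmod w) ^ 2 / 8))).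
    assert (Pw : 0 < (1 - Cmod w) ^ 2) by (apply pow_lt; lra).
    assert (Pt : 0 < t).
    { unfold t. repeat apply Rmin_case; try lra. nra. }
    assert (T1 : t <= (1 - Cmod z) / 2) by apply Rmin_l.
    assert (T2 : t <= (1 - Cmod w) / 2) by (eapply Rle_trans; [apply Rmin_r|apply Rmin_l]).
    assert (T3 : t <= eta * (1 - Cmod w) ^ 2 / 8)
      by (eapply Rle_trans; [apply Rmin_r|apply Rmin_r]).
    set (r := 1 - t).
    apply (maximum_modulus h w r (1 + eta)); unfold r; try lra.
    - apply C_continuous_mult; trivial. apply C_differentiable_continuous, Hlin.
    - intros x Hx Nx. apply C_differentiable_mult; [|apply Hlin].
      apply Cminus_neq_0 in Nx. assert (Px : 0 < Cmod (x - w)%C) by now apply Cmod_gt_0.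
      apply C_differentiable_near with (f := fun y => (g y / (y - w))%C)
        (delta := Cmod (x - w)%C); trivial.
      + intros y Hy. rewrite (Eg y). field. intros K.
        replace (y - x)%C with ((y - w) - (x - w))%C in Hy by ring. rewrite K in Hy.
        replace (0 - (x - w))%C with (- (x - w))%C in Hy by ring.
        rewrite Cmod_opp in Hy. lra.
      + apply C_differentiable_div; trivial; [apply Hd; lra|].
        apply C_differentiable_minus; [apply C_differentiable_id|apply C_differentiable_const].
    - intros x Hx.
      set (d := Cmod (x - w)%C).
      assert (Dd : (1 - Cmod w) / 2 <= d).
      { assert (T := Cmod_le_add_sub x w). unfold d. lra. }
      assert (Pd : 0 < d) by lra.
      assert (I := disk_automorphism_identity w x). fold d in I. rewrite Hx in I.
      assert (GB : Cmod (h x) * d <= Cmod (1 - Cconj w * x)%C).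
      { unfold d. rewrite <- Cmod_mult. unfold h.
        replace (q x * (1 - Cconj w * x) * (x - w))%C with (g x * (1 - Cconj w * x))%C
          by (rewrite (Eg x); ring).
        rewrite Cmod_mult. rewrite <- (Rmult_1_l (Cmod (1 - Cconj w * x)%C)) at 2.
        apply Rmult_le_compat_r; [apply Cmod_ge_0|]. apply Hb; lra. }
      assert (B : Cmod (1 - Cconj w * x)%C <= (1 + eta) * d).
      { apply sqr_le_reg.
        - nra.
        - rewrite I.
          (* |1 - conj w x|^2 <= d^2 + 2 t <= (1 + eta) d^2 *)
          assert (X : (1 - Cmod w ^ 2) * (1 - (1 - t) ^ 2) <= 1 * (2 * t)).
          { apply Rmult_le_compat; nra. }
          assert (Y : (1 - Cmod w) ^ 2 <= 4 * d ^ 2) by nra.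
          assert (Y' : eta * (1 - Cmod w) ^ 2 <= eta * (4 * d ^ 2))
            by (apply Rmult_le_compat_l; lra).
          nra. }
      apply Rmult_le_reg_r with d; lra. }
  rewrite (Eg z), Cmod_mult.
  unfold h in Hh. rewrite Cmod_mult in Hh.
  assert (D0 := Cmod_ge_0 (z - w)%C).
  assert (M := Rmult_le_compat_r _ _ _ D0 Hh). lra.
Qed.

(** Schwarz' lemma for f followed by the disk automorphism that sends f w to 0. *)
Lemma Schwarz_Pick : forall f,
  (forall z, Cmod z < 1 -> C_differentiable f z) ->
  (forall z, Cmod z < 1 -> Cmod (f z) < 1) ->
  forall w z, Cmod w < 1 -> Cmod z < 1 ->
  Cmod (f z - f w)%C * Cmod (1 - Cconj w * z)%C <=
  Cmod (z - w)%C * Cmod (1 - Cconj (f w) * f z)%C.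
Proof.
  intros f Hd Hb w z Hw Hz.
  assert (NZ : forall x, Cmod x < 1 -> 0 < Cmod (1 - Cconj (f w) * f x)%C).
  { intros x Hx. assert (T := Cmod_le_add_sub 1 (Cconj (f w) * f x)).
    rewrite Cmod_1, Cmod_mult, Cmod_conj in T.
    assert (A := Hb _ Hw). assert (B := Hb _ Hx).
    assert (A0 := Cmod_ge_0 (f w)). assert (B0 := Cmod_ge_0 (f x)). nra. }
  assert (NE : forall x, Cmod x < 1 -> (1 - Cconj (f w) * f x)%C <> 0)
    by (intros x Hx; now apply Cmod_gt_0, NZ).
  assert (S := Schwarz_lemma (fun x => (f x - f w) / (1 - Cconj (f w) * f x))%C w Hw).
  cbv beta in S.
  specialize (S) with (4 := Hz).
  assert (P := NZ z Hz).
  rewrite Cmod_div in S by now apply NE.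
  apply Rmult_le_reg_r with (/ Cmod (1 - Cconj (f w) * f z)%C);
    [now apply Rinv_0_lt_compat|].
  rewrite (Rmult_assoc (Cmod (z - w)%C)), Rinv_r, Rmult_1_r by lra.
  eapply Rle_trans; [|apply S].
  - right; unfold Rdiv; ring.
  - intros x Hx. apply C_differentiable_div; [| |now apply NE].
    + apply C_differentiable_minus; [now apply Hd|apply C_differentiable_const].
    + apply C_differentiable_minus; [apply C_differentiable_const|].
      apply C_differentiable_mult; [apply C_differentiable_const|now apply Hd].
  - intros x Hx. rewrite Cmod_div by now apply NE. specialize (NZ x Hx).
    apply Rmult_le_reg_r with (Cmod (1 - Cconj (f w) * f x)%C); trivial.
    unfold Rdiv. rewrite Rmult_assoc, Rinv_l, Rmult_1_r, Rmult_1_l by lra.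
    apply sqr_le_reg; [lra|].
    rewrite disk_automorphism_identity.
    assert (A := Hb _ Hw). assert (B := Hb _ Hx).
    assert (A0 := Cmod_ge_0 (f w)). assert (B0 := Cmod_ge_0 (f x)).
    assert (0 <= (1 - Cmod (f w) ^ 2) * (1 - Cmod (f x) ^ 2)); [|lra].
    apply Rmult_le_pos; nra.
  - replace (f w - f w)%C with (RtoC 0) by ring. unfold Cdiv. ring.
Qed.

(** * Julia's lemma *)

(** Lets the error terms of an inequality that holds up to small t > 0 tend to 0. *)
Lemma le_limit_at_right_0 : forall (phi psi : R -> R) d,
  continuous phi 0 -> continuous psi 0 -> 0 < d ->
  (forall t, 0 < t < d -> phi t <= psi t) -> phi 0 <= psi 0.
Proof.
  intros phi psi d H1 H2 Hd H.
  apply (filterlim_le (F := at_right 0) phi psi (Finite (phi 0)) (Finite (psi 0))).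
  - exists (mkposreal _ Hd). intros t Ht Pt. apply H. split; trivial.
    apply Rabs_lt_between' in Ht. simpl in Ht. lra.
  - intros P HP. apply filter_le_within. now apply H1.
  - intros P HP. apply filter_le_within. now apply H2.
Qed.

Lemma Cconj_R : forall r : R, Cconj r = r.
Proof. intros r. unfold Cconj, RtoC; simpl. now rewrite Ropp_0. Qed.

Lemma one_minus_neq_0 : forall z : C, Cmod z < 1 -> (1 - z)%C <> 0.
Proof.
  intros z Hz. apply Cminus_neq_0. intros E. rewrite <- E, Cmod_1 in Hz. lra.
Qed.

Lemma one_minus_Cmod : forall z : C, 1 - Cmod z <= Cmod (1 - z)%C.
Proof. intros z. assert (T := Cmod_le_add_sub 1 z). rewrite Cmod_1 in T. lra. Qed.

(** Schwarz-Pick between z and a radial point r reads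
      (1 - r^2) (1 - |z|^2) |1 - conj (f r) f z|^2
        <= (1 - |f r|^2) (1 - |f z|^2) |1 - r z|^2.
    As |f r - r| = o(1 - r), the quotient (1 - |f r|^2) / (1 - r^2) has upper limit
    at most 1, and r can be sent to 1. *)
Lemma Julia : forall f,
  (forall z, Cmod z < 1 -> C_differentiable f z) ->
  (forall z, Cmod z < 1 -> Cmod (f z) < 1) ->
  (forall eps, 0 < eps -> exists delta, 0 < delta /\
     forall r, 0 < r < 1 -> 1 - r < delta -> Cmod (f (RtoC r) - r)%C <= eps * (1 - r)) ->
  forall z, Cmod z < 1 ->
  Cmod (1 - f z)%C ^ 2 * (1 - Cmod z ^ 2) <= Cmod (1 - z)%C ^ 2 * (1 - Cmod (f z) ^ 2).
Proof.
  intros f Hd Hb Hr z Hz.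
  assert (Hfz := Hb z Hz).
  set (a := Cmod (1 - f z)%C). set (b := Cmod (1 - z)%C).
  assert (Pa : 0 < a) by now apply Cmod_gt_0, one_minus_neq_0.
  assert (Pb : 0 < b) by now apply Cmod_gt_0, one_minus_neq_0.
  assert (Z0 := Cmod_ge_0 z). assert (F0 := Cmod_ge_0 (f z)).
  set (m := 1 - Cmod z ^ 2). set (n := 1 - Cmod (f z) ^ 2).
  assert (Pm : 0 < m) by (unfold m; nra). assert (Pn : 0 < n) by (unfold n; nra).
  assert (K := le_limit_at_right_0 (fun t => (2 - t) * m * (a - 2 * t) ^ 2)
     (fun t => 2 * (1 + t) * n * (b + t) ^ 2) (Rmin (1 / 2) (a / 2))).
  assert (G : (2 - 0) * m * (a - 2 * 0) ^ 2 <= 2 * (1 + 0) * n * (b + 0) ^ 2).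
  { apply K.
    - apply (ex_derive_continuous (V := R_NormedModule)). auto_derive; trivial.
    - apply (ex_derive_continuous (V := R_NormedModule)). auto_derive; trivial.
    - apply Rmin_case; lra.
    - clear K. intros t [Pt Ht].
      assert (T1 := Rlt_le_trans _ _ _ Ht (Rmin_l _ _)).
      assert (T2 := Rlt_le_trans _ _ _ Ht (Rmin_r _ _)).
      destruct (Hr t Pt) as [d [Pd HD]].
      (* the radial point is r = 1 - u, with u < t absorbed in the error terms *)
      set (u := Rmin t d / 2).
      assert (Pu : 0 < u) by (unfold u; assert (0 < Rmin t d) by (apply Rmin_case; lra); lra).
      assert (U1 : u < t) by (unfold u; assert (X := Rmin_l t d); lra).
      assert (U2 : u < d) by (unfold u; assert (X := Rmin_r t d); lra).
      set (r := 1 - u).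
      assert (Cr : Cmod (RtoC r) = r) by (rewrite Cmod_R; apply Rabs_pos_eq; unfold r; lra).
      specialize (HD r ltac:(unfold r; lra) ltac:(unfold r; lra)).
      replace (1 - r) with u in HD by (unfold r; ring).
      assert (Hfr := Hb r ltac:(rewrite Cr; unfold r; lra)).
      assert (S := Schwarz_Pick f Hd Hb r z ltac:(rewrite Cr; unfold r; lra) Hz).
      assert (I1 := disk_automorphism_identity r z).
      assert (I2 := disk_automorphism_identity (f r) (f z)).
      fold m in I1. fold n in I2. rewrite Cr in I1.
      assert (N1 : Cmod (1 - f r)%C <= (1 + t) * u).
      { replace (1 - f r)%C with ((1 - r) + - (f r - r))%C by ring.
        eapply Rle_trans; [apply Cmod_triangle|]. rewrite Cmod_opp.
        rewrite <- RtoC_minus, Cmod_R, Rabs_pos_eq by (unfold r; lra).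
        unfold r in *; lra. }
      assert (N2 := one_minus_Cmod (f r)).
      assert (N3 : 1 - Cmod (f r) ^ 2 <= 2 * (1 + t) * u).
      { assert (X := Cmod_ge_0 (f r)). nra. }
      assert (N4 : Cmod (1 - Cconj r * z)%C <= b + t).
      { replace (1 - Cconj r * z)%C with ((1 - z) + (RtoC u) * z)%C.
        2:{ rewrite Cconj_R. unfold r. rewrite RtoC_minus. ring. }
        eapply Rle_trans; [apply Cmod_triangle|]. fold b.
        rewrite Cmod_mult, Cmod_R, Rabs_pos_eq by lra. nra. }
      assert (N5 : a - 2 * t <= Cmod (1 - Cconj (f r) * f z)%C).
      { assert (T := Cmod_le_add_sub (1 - f z) (1 - Cconj (f r) * f z)). fold a in T.
        replace (1 - f z - (1 - Cconj (f r) * f z))%C with ((Cconj (f r) - 1) * f z)%C in T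
          by ring.
        rewrite Cmod_mult in T.
        replace (Cconj (f r) - 1)%C with (- Cconj (1 - f r))%C in T.
        2:{ rewrite Cminus_conj, Cconj_R. ring. }
        rewrite Cmod_opp, Cmod_conj in T.
        assert (X := Cmod_ge_0 (1 - f r)%C).
        assert (Cmod (1 - f r)%C * Cmod (f z) <= 2 * t); [|lra].
        apply Rle_trans with (Cmod (1 - f r)%C * 1); nra. }
      set (X := Cmod (1 - Cconj r * z)%C) in *.
      set (Y := Cmod (1 - Cconj (f r) * f z)%C) in *.
      assert (X0 : 0 <= X) by apply Cmod_ge_0. assert (Y0 : 0 <= Y) by apply Cmod_ge_0.
      assert (S2 : (Cmod (f z - f r)%C * X) ^ 2 <= (Cmod (z - r)%C * Y) ^ 2).
      { apply pow_incr. split; trivial. apply Rmult_le_pos; trivial. apply Cmod_ge_0. }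
      rewrite !Rpow_mult_distr in S2.
      assert (S3 : (1 - r ^ 2) * m * Y ^ 2 <= (1 - Cmod (f r) ^ 2) * n * X ^ 2).
      { replace (Cmod (f z - f r)%C ^ 2) with (Y ^ 2 - (1 - Cmod (f r) ^ 2) * n) in S2 by lra.
        replace (Cmod (z - r)%C ^ 2) with (X ^ 2 - (1 - r ^ 2) * m) in S2 by lra. lra. }
      assert (S4 : (1 - r ^ 2) * m * Y ^ 2 <= 2 * (1 + t) * u * (n * X ^ 2)).
      { eapply Rle_trans; [apply S3|]. rewrite Rmult_assoc.
        apply Rmult_le_compat_r; trivial. apply Rmult_le_pos; [lra|apply pow2_ge_0]. }
      replace (1 - r ^ 2) with (u * (2 - u)) in S4 by (unfold r; ring).
      assert (S5 : (2 - u) * m * Y ^ 2 <= 2 * (1 + t) * (n * X ^ 2)).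
      { apply Rmult_le_reg_l with u; trivial. lra. }
      assert (Y2 : (a - 2 * t) ^ 2 <= Y ^ 2 \/ a - 2 * t < 0).
      { destruct (Rlt_dec (a - 2 * t) 0); [now right|left]. apply pow_incr; lra. }
      assert (X2 : X ^ 2 <= (b + t) ^ 2) by (apply pow_incr; lra).
      destruct Y2 as [Y2|Y2]; [|lra].
      apply Rle_trans with ((2 - u) * m * Y ^ 2).
      + apply Rmult_le_compat; trivial; try apply pow2_ge_0.
        * apply Rmult_le_pos; lra.
        * apply Rmult_le_compat_r; lra.
      + eapply Rle_trans; [apply S5|]. rewrite (Rmult_assoc (2 * (1 + t))).
        apply Rmult_le_compat_l; [lra|]. apply Rmult_le_compat_l; lra. }
  lra.
Qed.

(** * Maps into the right half-plane *)

Definition cayley (z : C) : C := ((1 + z) / (1 - z))%C.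

Lemma Re_cayley : forall z, Cmod z < 1 ->
  Re (cayley z) = (1 - Cmod z ^ 2) / Cmod (1 - z)%C ^ 2.
Proof.
  intros z Hz. assert (N := one_minus_neq_0 z Hz). apply Cmod_gt_0 in N.
  assert (P : 0 < Cmod (1 - z)%C ^ 2) by now apply pow_lt.
  rewrite !Cmod2_alt in *. destruct z as [x y].
  unfold cayley, Cdiv, Cinv, Re, Im in *; simpl in *. field. lra.
Qed.

Lemma cayley_inj : forall z w, Cmod z < 1 -> Cmod w < 1 -> cayley z = cayley w -> z = w.
Proof.
  intros z w Hz Hw E. unfold cayley in E.
  assert (Nz := one_minus_neq_0 z Hz). assert (Nw := one_minus_neq_0 w Hw).
  assert (H : ((1 + z) * (1 - w))%C = ((1 + w) * (1 - z))%C).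
  { transitivity ((1 + z) / (1 - z) * ((1 - z) * (1 - w)))%C; [now field|].
    rewrite E. now field. }
  assert (H2 : (RtoC 2 * (z - w))%C = 0).
  { transitivity ((1 + z) * (1 - w) - (1 + w) * (1 - z))%C; [ring|]. rewrite H. ring. }
  apply (f_equal Cmod) in H2. rewrite Cmod_mult, Cmod_0, Cmod_R, Rabs_pos_eq in H2 by lra.
  apply Rmult_integral in H2. destruct H2 as [H2|H2]; [lra|].
  apply Cmod_eq_0 in H2. replace z with ((z - w) + w)%C by ring. rewrite H2. ring.
Qed.

Lemma cayley_differentiable : forall f z, C_differentiable f z -> Cmod (f z) < 1 ->
  C_differentiable (fun x => cayley (f x)) z.
Proof.
  intros f z Hf H. unfold cayley. apply C_differentiable_div.
  - apply C_differentiable_plus; trivial. apply C_differentiable_const.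
  - apply C_differentiable_minus; trivial. apply C_differentiable_const.
  - now apply one_minus_neq_0.
Qed.

(** (p - p 0) / (p + conj (p 0)) maps into the closed disk when Re p > 0. Replacing
    p by p + eps / 2 only adds eps to the denominator, which handles Re p >= 0. *)
Lemma half_plane_Schwarz : forall p,
  (forall z, Cmod z < 1 -> C_differentiable p z) ->
  (forall z, Cmod z < 1 -> 0 <= Re (p z)) ->
  forall z, Cmod z < 1 ->
  Cmod (p z - p 0)%C <= Cmod z * Cmod (p z + Cconj (p 0))%C.
Proof.
  intros p Hd Hp z Hz.
  assert (H0 := Hp 0 ltac:(rewrite Cmod_0; lra)).
  apply le_epsilon. intros eps He.
  assert (B : forall x, Cmod x < 1 -> Cmod (p x - p 0)%C <= Cmod (p x + Cconj (p 0) + eps)%C /\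
     0 < Cmod (p x + Cconj (p 0) + eps)%C).
  { intros x Hx. specialize (Hp x Hx). split.
    - apply sqr_le_reg; [apply Cmod_ge_0|]. rewrite !Cmod2_alt.
      destruct (p x) as [a b]. destruct (p 0) as [c d].
      unfold Re, Im in *; simpl in *. nra.
    - eapply Rlt_le_trans; [|apply re_le_Cmod].
      eapply Rlt_le_trans; [|apply Rle_abs].
      unfold Re in *; simpl. lra. }
  assert (S := Schwarz_lemma (fun x => (p x - p 0) / (p x + Cconj (p 0) + eps))%C 0).
  cbv beta in S. rewrite Cmod_0 in S. specialize (S Rlt_0_1).
  destruct (B z Hz) as [_ Pz].
  assert (S' : Cmod ((p z - p 0) / (p z + Cconj (p 0) + eps))%C * Cmod (1 - Cconj 0 * z)%C
     <= Cmod (z - 0)%C).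
  { apply S; trivial.
    - intros x Hx. apply C_differentiable_div.
      + apply C_differentiable_minus; [auto|apply C_differentiable_const].
      + apply (C_differentiable_plus (fun x => p x + Cconj (p 0))%C);
          [|apply C_differentiable_const].
        apply C_differentiable_plus; [auto|apply C_differentiable_const].
      + apply Cmod_gt_0. now apply B.
    - intros x Hx. destruct (B x Hx) as [B1 B2].
      rewrite Cmod_div by now apply Cmod_gt_0.
      apply Rmult_le_reg_r with (Cmod (p x + Cconj (p 0) + eps)%C); trivial.
      unfold Rdiv. rewrite Rmult_assoc, Rinv_l; lra.
    - replace (p 0 - p 0)%C with (RtoC 0) by ring. unfold Cdiv. ring. }
  replace (z - 0)%C with z in S' by ring.
  replace (1 - Cconj 0 * z)%C with (RtoC 1) in S'.
  2:{ rewrite Cconj_R. ring. }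
  rewrite Cmod_1, Rmult_1_r, Cmod_div in S' by now apply Cmod_gt_0.
  apply Rmult_le_compat_r with (r := Cmod (p z + Cconj (p 0) + eps)%C) in S'; [|lra].
  unfold Rdiv in S'. rewrite Rmult_assoc, Rinv_l, Rmult_1_r in S' by lra.
  eapply Rle_trans; [apply S'|].
  assert (T := Cmod_triangle (p z + Cconj (p 0)) eps).
  rewrite (Cmod_R eps), Rabs_pos_eq in T by lra.
  assert (Z0 := Cmod_ge_0 z). nra.
Qed.

(** The imaginary parts enter both sides of [half_plane_Schwarz] in the same way and
    can be discarded because |z| < 1. *)
Lemma Harnack : forall p,
  (forall z, Cmod z < 1 -> C_differentiable p z) ->
  (forall z, Cmod z < 1 -> 0 <= Re (p z)) ->
  forall z, Cmod z < 1 -> Re (p 0) * (1 - Cmod z) <= Re (p z) * (1 + Cmod z).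
Proof.
  intros p Hd Hp z Hz.
  assert (S := half_plane_Schwarz p Hd Hp z Hz).
  assert (H0 := Hp 0 ltac:(rewrite Cmod_0; lra)). specialize (Hp z Hz).
  assert (Z0 := Cmod_ge_0 z).
  set (t := Cmod z) in *.
  assert (S2 : Cmod (p z - p 0)%C ^ 2 <= (t * Cmod (p z + Cconj (p 0))%C) ^ 2)
    by (apply pow_incr; split; trivial; apply Cmod_ge_0).
  rewrite Rpow_mult_distr, !Cmod2_alt in S2.
  destruct (p z) as [a b]. destruct (p 0) as [c d]. unfold Re, Im in *; simpl in *.
  assert (c - a <= t * (a + c)); [|lra].
  apply sqr_le_reg; [nra|].
  assert (t ^ 2 <= 1) by nra.
  assert (0 <= (1 - t ^ 2) * (b - d) ^ 2) by (apply Rmult_le_pos; [lra|apply pow2_ge_0]).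
  nra.
Qed.

(** When p 0 lies on the boundary of the half-plane, conj (p 0) = - p 0, and the
    inequality bounds |p z - p 0| by |z| times itself. *)
Lemma half_plane_boundary_value_constant : forall p,
  (forall z, Cmod z < 1 -> C_differentiable p z) ->
  (forall z, Cmod z < 1 -> 0 <= Re (p z)) ->
  Re (p 0) = 0 ->
  forall z, Cmod z < 1 -> p z = p 0.
Proof.
  intros p Hd Hp H0 z Hz.
  assert (S := half_plane_Schwarz p Hd Hp z Hz).
  replace (p z + Cconj (p 0))%C with (p z - p 0)%C in S.
  2:{ destruct (p z) as [a b]; destruct (p 0) as [c d]. unfold Re in H0; simpl in H0. subst c.
      unfold Cminus, Cplus, Copp, Cconj; simpl. f_equal; ring. }
  assert (X := Cmod_ge_0 (p z - p 0)%C).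
  assert (E : Cmod (p z - p 0)%C = 0) by nra.
  apply Cmod_eq_0 in E. replace (p z) with ((p z - p 0) + p 0)%C by ring. rewrite E. ring.
Qed.

(** * Consequences of the non-tangential and compactness hypotheses *)

Lemma Cminus_0_r : forall z : C, (z - 0)%C = z.
Proof. intros z; ring. Qed.

(** The radius lies in the approach region of aperture 2. *)
Lemma radial_estimate : forall (f : C -> C),
  nontangential_little_o (fun z : C => (f z - z)%C) (fun z : C => (z - 1)%C) ->
  forall eps, 0 < eps -> exists delta, 0 < delta /\
     forall r, 0 < r < 1 -> 1 - r < delta -> Cmod (f (RtoC r) - r)%C <= eps * (1 - r).
Proof.
  intros f H eps He.
  specialize (H 2 ltac:(lra)).
  assert (HB : locally (0 : C) (fun y : C => Cmod y < eps)).
  { apply locally_C. exists (mkposreal _ He). intros y Hy.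
    change (Cmod (y - 0)%C < eps) in Hy. now rewrite Cminus_0_r in Hy. }
  specialize (H _ HB). unfold filtermap, within in H. apply locally_C in H.
  destruct H as [d Hd]. exists d. split; [apply cond_pos|].
  intros r Hr Hrd.
  assert (E : Cmod (r - 1)%C = 1 - r).
  { rewrite <- RtoC_minus, Cmod_R, Rabs_left; lra. }
  assert (Cr : Cmod (RtoC r) = r) by (rewrite Cmod_R; apply Rabs_pos_eq; lra).
  specialize (Hd (RtoC r)).
  assert (K : Cmod ((f r - r) / (r - 1))%C < eps).
  { apply Hd.
    - change (Cmod (r - 1)%C < d). lra.
    - split; [unfold unit_disk; rewrite Cr; lra|]. rewrite E, Cr. lra. }
  assert (N : (r - 1)%C <> 0) by (apply Cmod_gt_0; lra).
  rewrite Cmod_div, E in K by trivial.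
  apply Rmult_lt_compat_r with (r := 1 - r) in K; [|lra].
  unfold Rdiv in K. rewrite Rmult_assoc, Rinv_l in K; lra.
Qed.

Lemma compact_in_disk : forall K : C -> Prop, compact_set K ->
  (forall z, K z -> unit_disk z) ->
  exists rho, 0 <= rho < 1 /\ forall z, K z -> Cmod z <= rho.
Proof.
  intros K HK Hin.
  destruct (HK R (fun s (z : C) => s < 1 /\ Cmod z < s)) as [l Hl].
  - intros s x [Hs Hx]. apply locally_C.
    assert (P : 0 < s - Cmod x) by lra.
    exists (mkposreal _ P). intros y Hy. change (Cmod (y - x)%C < s - Cmod x) in Hy.
    assert (T := Cmod_le_add_sub y x). split; lra.
  - intros z Hz. specialize (Hin z Hz). unfold unit_disk in Hin.
    exists ((1 + Cmod z) / 2). lra.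
  - assert (HB : exists rho, 0 <= rho < 1 /\ forall s, In s l -> s < 1 -> s <= rho).
    { clear Hl. induction l as [|s l [rho [Hr IH]]].
      - exists 0. split; [lra|]. intros s [].
      - destruct (Rlt_dec s 1) as [L|L].
        + exists (Rmax s rho). split.
          * split; [apply Rle_trans with rho; [lra|apply Rmax_r]|apply Rmax_lub_lt; lra].
          * intros u [<- | Hu] Hu1; [apply Rmax_l|].
            eapply Rle_trans; [now apply IH|apply Rmax_r].
        + exists rho. split; trivial. intros u [<- | Hu] Hu1; [lra|auto]. }
    destruct HB as [rho [Hr HB]]. exists rho. split; trivial.
    intros z Hz. destruct (Hl z Hz) as [s [Hs [S1 S2]]]. specialize (HB s Hs S1). lra.
Qed.

(** * The displacement in the half-plane *)

Section Displacement.

Variable f : C -> C.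
Hypothesis Hd : forall z, Cmod z < 1 -> C_differentiable f z.
Hypothesis Hb : forall z, Cmod z < 1 -> Cmod (f z) < 1.
Hypothesis HJ : forall z, Cmod z < 1 ->
  Cmod (1 - f z)%C ^ 2 * (1 - Cmod z ^ 2) <= Cmod (1 - z)%C ^ 2 * (1 - Cmod (f z) ^ 2).

Let p (z : C) : C := (cayley (f z) - cayley z)%C.

Lemma displacement_differentiable : forall z, Cmod z < 1 -> C_differentiable p z.
Proof.
  intros z Hz. apply C_differentiable_minus.
  - apply cayley_differentiable; auto.
  - apply (cayley_differentiable (fun x => x)); trivial. apply C_differentiable_id.
Qed.

Lemma displacement_Re : forall z, Cmod z < 1 -> 0 <= Re (p z).
Proof.
  intros z Hz. unfold p.
  replace (Re (cayley (f z) - cayley z)%C) with (Re (cayley (f z)) - Re (cayley z))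
    by (unfold Re; simpl; ring).
  rewrite !Re_cayley by auto. specialize (HJ z Hz).
  assert (N1 := one_minus_neq_0 z Hz). assert (N2 := one_minus_neq_0 (f z) (Hb z Hz)).
  apply Cmod_gt_0 in N1. apply Cmod_gt_0 in N2.
  set (a := Cmod (1 - z)%C ^ 2) in *. set (b := Cmod (1 - f z)%C ^ 2) in *.
  assert (Pa : 0 < a) by now apply pow_lt. assert (Pb : 0 < b) by now apply pow_lt.
  assert (L : (1 - Cmod z ^ 2) / a <= (1 - Cmod (f z) ^ 2) / b); [|lra].
  apply Rmult_le_reg_r with (a * b); [now apply Rmult_lt_0_compat|].
  replace ((1 - Cmod z ^ 2) / a * (a * b)) with ((1 - Cmod z ^ 2) * b) by (field; lra).
  replace ((1 - Cmod (f z) ^ 2) / b * (a * b)) with ((1 - Cmod (f z) ^ 2) * a)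
    by (field; lra).
  lra.
Qed.

Lemma displacement_0_identity : p 0 = 0 -> forall z, Cmod z < 1 -> f z = z.
Proof.
  intros E z Hz. apply cayley_inj; auto.
  assert (K := half_plane_boundary_value_constant p displacement_differentiable
    displacement_Re ltac:(rewrite E; reflexivity) z Hz).
  rewrite E in K. unfold p in K.
  replace (cayley (f z)) with ((cayley (f z) - cayley z) + cayley z)%C by ring.
  rewrite K. ring.
Qed.

(** At a zero of p, [half_plane_Schwarz] reads |p 0| <= |z| |p 0|. *)
Lemma fixed_point_displacement_0 : forall z, Cmod z < 1 -> f z = z -> p 0 = 0.
Proof.
  intros z Hz E.
  assert (S := half_plane_Schwarz p displacement_differentiable displacement_Re z Hz).
  replace (p z) with (RtoC 0) in S by (unfold p; rewrite E; ring).
  replace (0 - p 0)%C with (- p 0)%C in S by ring.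
  replace (0 + Cconj (p 0))%C with (Cconj (p 0)) in S by ring.
  rewrite Cmod_opp, Cmod_conj in S.
  assert (X := Cmod_ge_0 (p 0)). apply Cmod_eq_0. nra.
Qed.

Lemma horodisk_invariant : forall rho z,
  horodisk (RtoC 1) rho z -> horodisk (RtoC 1) rho (f z).
Proof.
  intros rho z [Hz H]. unfold unit_disk in Hz. split; [now apply Hb|].
  eapply Rle_lt_trans; [|apply H]. specialize (HJ z Hz).
  assert (Z0 := Cmod_ge_0 z). assert (F0 := Cmod_ge_0 (f z)). specialize (Hb z Hz).
  assert (Pa : 0 < 1 - Cmod z ^ 2) by nra. assert (Pb : 0 < 1 - Cmod (f z) ^ 2) by nra.
  set (a := 1 - Cmod z ^ 2) in *. set (b := 1 - Cmod (f z) ^ 2) in *.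
  apply Rmult_le_reg_r with (a * b); [now apply Rmult_lt_0_compat|].
  replace (Cmod (1 - f z)%C ^ 2 / b * (a * b)) with (Cmod (1 - f z)%C ^ 2 * a)
    by (field; lra).
  replace (Cmod (1 - z)%C ^ 2 / a * (a * b)) with (Cmod (1 - z)%C ^ 2 * b) by (field; lra).
  trivial.
Qed.

Lemma iter_in_disk : forall k z, Cmod z < 1 -> Cmod (Nat.iter k f z) < 1.
Proof. intros k z Hz. induction k; simpl; auto. Qed.

(** With t_k = (1 - |z_k|) / (1 + |z_k|) and J_k = Re (cayley z_k), Harnack gives
    Re (p 0) t_k <= J_(k+1) - J_k, and t_k <= 1 / J_k holds at every point of the disk.
    Since J increases, t_k tends to 0 by the first bound if J is bounded and by the
    second otherwise. Finally |1 - z_k|^2 = (1 - |z_k|^2) / J_k <= 4 t_k as J_k >= 1. *)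
Lemma orbit_of_0_drifting : 0 < Re (p 0) ->
  forall eps, 0 < eps -> eventually (fun k => Cmod (1 - Nat.iter k f 0)%C < eps).
Proof.
  intros Pp eps He.
  set (z := fun k => Nat.iter k f 0).
  assert (Hz : forall k, Cmod (z k) < 1).
  { intros k. apply iter_in_disk. rewrite Cmod_0; lra. }
  set (J := fun k => Re (cayley (z k))).
  assert (HJp : forall k, J (S k) - J k = Re (p (z k))).
  { intros k. unfold J, p. change (z (S k)) with (f (z k)). unfold Re; simpl; ring. }
  assert (Jinc : forall k, J k <= J (S k)).
  { intros k. specialize (HJp k). assert (X := displacement_Re (z k) (Hz k)). lra. }
  assert (J0 : J O = 1).
  { unfold J, z, cayley. simpl. rewrite Rplus_0_r. unfold Re; simpl. field. }
  assert (J1 : forall k, 1 <= J k).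
  { induction k as [|k IH]; [lra|]. specialize (Jinc k). lra. }
  set (t := fun k => (1 - Cmod (z k)) / (1 + Cmod (z k))).
  assert (Z0 : forall k, 0 <= Cmod (z k)) by (intros; apply Cmod_ge_0).
  assert (Pt : forall k, 0 < t k).
  { intros k. specialize (Hz k). specialize (Z0 k). apply Rdiv_lt_0_compat; lra. }
  assert (T1 : forall k, t k <= (J (S k) - J k) / Re (p 0)).
  { intros k. rewrite HJp.
    assert (X := Harnack p displacement_differentiable displacement_Re (z k) (Hz k)).
    specialize (Z0 k). unfold t.
    apply Rmult_le_reg_r with (Re (p 0) * (1 + Cmod (z k)));
      [apply Rmult_lt_0_compat; lra|].
    match goal with |- ?l <= ?r =>
      replace l with (Re (p 0) * (1 - Cmod (z k))) by (field; lra);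
      replace r with (Re (p (z k)) * (1 + Cmod (z k))) by (field; lra) end.
    trivial. }
  assert (HJE : forall k, J k * Cmod (1 - z k)%C ^ 2 = 1 - Cmod (z k) ^ 2).
  { intros k. unfold J. rewrite Re_cayley by trivial.
    assert (N := one_minus_neq_0 (z k) (Hz k)). apply Cmod_gt_0 in N. field; lra. }
  assert (T2 : forall k, t k <= / J k).
  { intros k. specialize (Z0 k). specialize (Hz k). specialize (J1 k). specialize (HJE k).
    assert (X := one_minus_Cmod (z k)).
    assert (X2 : (1 - Cmod (z k)) ^ 2 <= Cmod (1 - z k)%C ^ 2) by (apply pow_incr; lra).
    assert (X3 : J k * (1 - Cmod (z k)) ^ 2 <= 1 - Cmod (z k) ^ 2).
    { rewrite <- HJE. apply Rmult_le_compat_l; lra. }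
    assert (X4 : J k * (1 - Cmod (z k)) <= 1 + Cmod (z k)).
    { apply Rmult_le_reg_r with (1 - Cmod (z k)); [lra|]. lra. }
    unfold t. apply Rmult_le_reg_r with (J k * (1 + Cmod (z k))); [nra|].
    match goal with |- ?l <= ?r =>
      replace l with (J k * (1 - Cmod (z k))) by (field; lra);
      replace r with (1 + Cmod (z k)) by (field; lra) end.
    trivial. }
  assert (T3 : forall k, Cmod (1 - z k)%C ^ 2 <= 4 * t k).
  { intros k. specialize (Z0 k). specialize (Hz k). specialize (J1 k). specialize (HJE k).
    assert (X : Cmod (1 - z k)%C ^ 2 <= 1 - Cmod (z k) ^ 2).
    { assert (Y := pow2_ge_0 (Cmod (1 - z k)%C)). nra. }
    eapply Rle_trans; [apply X|].
    unfold t. apply Rmult_le_reg_r with (1 + Cmod (z k)); [lra|].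
    match goal with |- _ <= ?r =>
      replace r with (4 * (1 - Cmod (z k))) by (field; lra) end. nra. }
  assert (LT : is_lim_seq t 0).
  { destruct (ex_lim_seq_incr J Jinc) as [L HL]. destruct L as [L| |].
    - apply (is_lim_seq_le_le (fun _ => 0) t (fun k => (J (S k) - J k) / Re (p 0))).
      + intros k; split; [apply Rlt_le, Pt|apply T1].
      + apply is_lim_seq_const.
      + replace (Finite 0) with (Rbar_mult (L - L) (/ Re (p 0)))
          by (simpl; f_equal; ring).
        apply is_lim_seq_scal_r. apply is_lim_seq_minus'; trivial.
        now apply (is_lim_seq_incr_1 J).
    - apply (is_lim_seq_le_le (fun _ => 0) t (fun k => / J k)).
      + intros k; split; [apply Rlt_le, Pt|apply T2].
      + apply is_lim_seq_const.
      + now apply (is_lim_seq_inv J p_infty).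
    - exfalso. assert (X := is_lim_seq_le (fun _ => 1) J 1 m_infty J1
        (is_lim_seq_const 1) HL). exact X. }
  apply is_lim_seq_spec in LT.
  assert (Pe2 : 0 < eps ^ 2) by now apply pow_lt.
  assert (Pe : 0 < eps ^ 2 / 4) by lra.
  destruct (LT (mkposreal _ Pe)) as [N HN]. exists N. intros k Hk.
  specialize (HN k Hk). simpl in HN. rewrite Rminus_0_r, Rabs_pos_eq in HN
    by (apply Rlt_le, Pt).
  specialize (T3 k).
  apply Rnot_le_lt. intros G. change (eps <= Cmod (1 - z k)%C) in G.
  assert (eps ^ 2 <= Cmod (1 - z k)%C ^ 2) by (apply pow_incr; lra). simpl in *. lra.
Qed.

(** Here f is conjugate to the translation by p 0, which is purely imaginary, so
    1 - z_k = 2 / (2 + k p 0). *)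
Lemma orbit_of_0_parabolic : Re (p 0) = 0 -> p 0 <> 0 ->
  forall eps, 0 < eps -> eventually (fun k => Cmod (1 - Nat.iter k f 0)%C < eps).
Proof.
  intros E0 N0 eps He.
  set (z := fun k => Nat.iter k f 0).
  assert (Hz : forall k, Cmod (z k) < 1).
  { intros k. apply iter_in_disk. rewrite Cmod_0; lra. }
  assert (W : forall k, cayley (z k) = (1 + INR k * p 0)%C).
  { induction k as [|k IH].
    - unfold z, cayley; simpl. field.
    - assert (K := half_plane_boundary_value_constant p displacement_differentiable
        displacement_Re E0 (z k) (Hz k)).
      unfold p at 1 in K. change (z (S k)) with (f (z k)).
      replace (cayley (f (z k))) with (cayley (f (z k)) - cayley (z k) + cayley (z k))%C
        by ring.
      rewrite K, IH, S_INR, RtoC_plus. ring. }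
  assert (P0 : 0 < Cmod (p 0)) by now apply Cmod_gt_0.
  destruct (nfloor_ex (2 / (eps * Cmod (p 0)))) as [N [_ HN]].
  { apply Rlt_le, Rdiv_lt_0_compat; [lra|]. now apply Rmult_lt_0_compat. }
  exists (S N). intros k Hk. change (Cmod (1 - z k)%C < eps).
  assert (Nz := one_minus_neq_0 (z k) (Hz k)).
  assert (M : ((2 + INR k * p 0) * (1 - z k))%C = 2).
  { replace (2 + INR k * p 0)%C with ((1 + INR k * p 0) + 1)%C by ring.
    rewrite <- W. unfold cayley. now field. }
  apply (f_equal Cmod) in M.
  rewrite Cmod_mult, (Cmod_R 2), Rabs_pos_eq in M by lra.
  assert (B : INR k * Cmod (p 0) <= Cmod (2 + INR k * p 0)%C).
  { apply sqr_le_reg; [apply Cmod_ge_0|]. rewrite Rpow_mult_distr, !Cmod2_alt.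
    destruct (p 0) as [a b]. unfold Re, Im in *; simpl in *. subst a. nra. }
  assert (Hk' : 2 / (eps * Cmod (p 0)) < INR k).
  { eapply Rlt_le_trans; [apply HN|]. rewrite <- S_INR. now apply le_INR. }
  apply Rmult_lt_compat_r with (r := eps * Cmod (p 0)) in Hk';
    [|now apply Rmult_lt_0_compat].
  replace (2 / (eps * Cmod (p 0)) * (eps * Cmod (p 0))) with 2 in Hk' by (field; lra).
  apply Cmod_gt_0 in Nz.
  apply Rnot_le_lt. intros G.
  assert (0 <= INR k) by apply pos_INR.
  assert (INR k * Cmod (p 0) * eps <= Cmod (2 + INR k * p 0)%C * Cmod (1 - z k)%C).
  { apply Rmult_le_compat; trivial; [|lra]. apply Rmult_le_pos; lra. }
  lra.
Qed.

(** Iterated Schwarz-Pick: the pseudo-hyperbolic distance between the orbits of 0 and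
    z never exceeds its initial value |z|. *)
Lemma orbits_stay_close : forall rho z k, 0 <= rho -> Cmod z <= rho -> Cmod z < 1 ->
  let a := Nat.iter k f 0 in let b := Nat.iter k f z in
  Cmod (b - a)%C <= rho * Cmod (1 - Cconj a * b)%C.
Proof.
  intros rho z k Hrho Hz Hz1. induction k as [|k IH].
  - simpl. replace (z - 0)%C with z by ring.
    rewrite Cconj_R. replace (1 - 0 * z)%C with (RtoC 1) by ring. rewrite Cmod_1. lra.
  - simpl in *. set (a := Nat.iter k f 0) in *. set (b := Nat.iter k f z) in *.
    assert (Ha : Cmod a < 1) by (apply iter_in_disk; rewrite Cmod_0; lra).
    assert (Hb' : Cmod b < 1) by now apply iter_in_disk.
    assert (S := Schwarz_Pick f Hd Hb a b Ha Hb').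
    assert (I := disk_automorphism_identity a b).
    assert (A0 := Cmod_ge_0 a). assert (B0 := Cmod_ge_0 b).
    assert (X : 0 < Cmod (1 - Cconj a * b)%C).
    { assert (T := one_minus_Cmod (Cconj a * b)%C).
      rewrite Cmod_mult, Cmod_conj in T. nra. }
    apply Rmult_le_reg_r with (Cmod (1 - Cconj a * b)%C); trivial.
    eapply Rle_trans; [apply S|].
    assert (Y := Cmod_ge_0 (1 - Cconj (f a) * f b)%C).
    assert (M := Rmult_le_compat_r _ _ _ Y IH). lra.
Qed.

(** If a is near 1, so is any b at pseudo-hyperbolic distance at most rho from a:
    [disk_automorphism_identity] gives (1 - rho^2) |1 - conj a b| <= 4 |1 - a|. *)
Lemma iterates_converge :
  (forall eps, 0 < eps -> eventually (fun k => Cmod (1 - Nat.iter k f 0)%C < eps)) ->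
  cvg_unif_on_compacts (fun k z => Nat.iter k f z) unit_disk (fun _ => RtoC 1).
Proof.
  intros H0 K HK Hin eps.
  destruct (compact_in_disk K HK Hin) as [rho [Hr HB]].
  set (c := 4 / (1 - rho ^ 2) + 1).
  assert (Pr : 0 < 1 - rho ^ 2) by nra.
  assert (Pc : 0 < c).
  { unfold c. assert (0 < 4 / (1 - rho ^ 2)) by (apply Rdiv_lt_0_compat; lra). lra. }
  assert (Pe := cond_pos eps).
  destruct (H0 (eps / c)) as [N HN]; [now apply Rdiv_lt_0_compat|].
  exists N. intros k Hk z Hz. specialize (HN k Hk).
  assert (Hz1 := Hin z Hz). unfold unit_disk in Hz1.
  assert (CL := orbits_stay_close rho z k (proj1 Hr) (HB z Hz) Hz1). simpl in CL.
  assert (Ha : Cmod (Nat.iter k f 0) < 1) by (apply iter_in_disk; rewrite Cmod_0; lra).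
  assert (Hb' : Cmod (Nat.iter k f z) < 1) by now apply iter_in_disk.
  set (a := Nat.iter k f 0) in *. set (b := Nat.iter k f z) in *.
  assert (I := disk_automorphism_identity a b).
  assert (A0 := Cmod_ge_0 a). assert (B0 := Cmod_ge_0 b).
  assert (X1 := one_minus_Cmod (Cconj a * b)%C). rewrite Cmod_mult, Cmod_conj in X1.
  assert (X2 := one_minus_Cmod a).
  set (X := Cmod (1 - Cconj a * b)%C) in *. set (d := Cmod (1 - a)%C) in *.
  assert (PX : 0 < X) by nra.
  assert (D2 : Cmod (b - a)%C ^ 2 <= (rho * X) ^ 2)
    by (apply pow_incr; split; trivial; apply Cmod_ge_0).
  assert (Y1 : 1 - Cmod b ^ 2 <= 2 * X) by nra.
  assert (Y2 : 1 - Cmod a ^ 2 <= 2 * d) by nra.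
  assert (Y3 : (1 - Cmod a ^ 2) * (1 - Cmod b ^ 2) <= (2 * d) * (2 * X))
    by (apply Rmult_le_compat; nra).
  assert (Y4 : (1 - rho ^ 2) * X <= 4 * d).
  { apply Rmult_le_reg_r with X; trivial. nra. }
  assert (Y5 : X <= 4 / (1 - rho ^ 2) * d).
  { apply Rmult_le_reg_l with (1 - rho ^ 2); trivial.
    replace ((1 - rho ^ 2) * (4 / (1 - rho ^ 2) * d)) with (4 * d) by (field; lra). trivial. }
  assert (Y6 : Cmod (b - 1)%C <= X + d).
  { replace (b - 1)%C with (- ((1 - Cconj a * b) + (Cconj a - 1) * b))%C by ring.
    rewrite Cmod_opp. eapply Rle_trans; [apply Cmod_triangle|]. fold X.
    rewrite Cmod_mult. replace (Cconj a - 1)%C with (- Cconj (1 - a))%C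
      by (rewrite Cminus_conj, Cconj_R; ring).
    rewrite Cmod_opp, Cmod_conj. fold d.
    assert (0 <= d) by apply Cmod_ge_0. nra. }
  eapply Rle_lt_trans; [apply Y6|].
  apply Rle_lt_trans with (c * d); [unfold c; lra|].
  apply Rmult_lt_compat_l with (r := c) in HN; trivial.
  replace (c * (eps / c)) with (pos eps) in HN by (field; lra). trivial.
Qed.

(** The factor 1 / 16 collects |1 - f r|^2 >= (1 - r)^2 / 4 and, from Harnack,
    Re (p r) >= Re (p 0) (1 - r) / 2. *)
Lemma radial_displacement_bound : forall r, 0 < r < 1 ->
  Cmod (f r - r)%C <= 1 / 2 * (1 - r) ->
  (Re (p 0) + Cmod (p r) ^ 2) / 16 <= Re (f r - r)%C / (1 - r) ^ 3.
Proof.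
  intros r Hr Hf.
  assert (Cr : Cmod (RtoC r) = r) by (rewrite Cmod_R; apply Rabs_pos_eq; lra).
  assert (Hr1 : Cmod (RtoC r) < 1) by lra.
  assert (HH := Harnack p displacement_differentiable displacement_Re r Hr1).
  assert (Hp := displacement_Re r Hr1).
  assert (Hp0 := displacement_Re 0 ltac:(rewrite Cmod_0; lra)).
  rewrite Cr in HH.
  set (u := 1 - r) in *. assert (Pu : 0 < u < 1) by (unfold u; lra).
  assert (Hs : u / 2 <= Cmod (1 - f r)%C).
  { assert (T := Cmod_le_add_sub (1 - r) (1 - f r)).
    replace (1 - r - (1 - f r))%C with (f r - r)%C in T by ring.
    rewrite <- RtoC_minus, Cmod_R, Rabs_pos_eq in T by (unfold u in *; lra).
    unfold u in *. lra. }
  assert (HS : u ^ 2 / 4 <= Cmod (1 - f r)%C ^ 2).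
  { apply Rle_trans with ((u / 2) ^ 2); [right; field|]. apply pow_incr; lra. }
  assert (E : Re (f r - r)%C = Cmod (1 - f r)%C ^ 2 * (Re (p r) / 2 + u * Cmod (p r) ^ 2 / 4)).
  { assert (N := one_minus_neq_0 _ (Hb _ Hr1)). apply Cmod_gt_0 in N.
    assert (N2 : 0 < Cmod (1 - f r)%C ^ 2) by now apply pow_lt.
    rewrite !Cmod2_alt in *. unfold p, cayley.
    destruct (f r) as [x y]. unfold u, Cdiv, Cinv, Re, Im in *; simpl in *.
    field. split; lra. }
  rewrite E.
  set (S := Cmod (1 - f r)%C ^ 2) in *. set (q := Cmod (p r) ^ 2) in *.
  assert (Q0 : 0 <= q) by apply pow2_ge_0.
  assert (HR : Re (p 0) * u / 2 <= Re (p r)) by (unfold u in *; nra).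
  assert (P3 : 0 < u ^ 3) by (apply pow_lt; lra).
  apply Rmult_le_reg_r with (u ^ 3); trivial.
  unfold Rdiv at 2. rewrite Rmult_assoc, Rinv_l, Rmult_1_r by lra.
  apply Rle_trans with (u ^ 2 / 4 * (Re (p 0) * u / 2 / 2 + u * q / 4)).
  - right; field.
  - assert (0 <= Re (p 0) * u) by (apply Rmult_le_pos; lra).
    assert (0 <= u * q) by (apply Rmult_le_pos; lra).
    assert (U0 := pow2_ge_0 u).
    apply Rmult_le_compat; lra.
Qed.

End Displacement.

(** * The theorem *)

Lemma LimInf_filter_pos : forall (phi : R -> R) F c, 0 < c ->
  F (fun t => c <= phi t) -> Rbar_lt (Finite 0) (LimInf_filter phi F).
Proof.
  intros phi F c Hc HF.
  set (P := fun t : R => c <= phi t) in HF.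
  apply Rbar_lt_le_trans with (Finite c); [exact Hc|].
  apply Rbar_le_trans with (Glb_Rbar (fun v : R => exists t, P t /\ v = phi t)).
  - apply (Glb_Rbar_correct (fun v : R => exists t, P t /\ v = phi t)).
    intros v [t [Ht ->]]. exact Ht.
  - unfold LimInf_filter, Rbar_lub.
    match goal with |- context [Rbar_ex_lub ?E] => destruct (Rbar_ex_lub E) as [l [Hl Hmin]] end.
    simpl. apply Hl. now exists P.
Qed.

Theorem theorem2p4 :
  forall f : C -> C,
    holomorphic_self_map f ->
    nontangential_little_o (fun z : C => (f z - z)%C) (fun z : C => (z - 1)%C) ->
    (forall z : C, unit_disk z -> f z = z) \/
    (wolff_point f (RtoC 1) /\
     cvg_unif_on_compacts (fun k z => Nat.iter k f z) unit_disk (fun _ => RtoC 1) /\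
     Rbar_lt (Finite 0)
       (LimInf_filter (fun r : R => Re (f (RtoC r) - RtoC r)%C / (1 - r) ^ 3)
          (at_left 1))).
Proof.
  intros f [Hb Hder] Ho.
  assert (Hd : forall z, Cmod z < 1 -> C_differentiable f z)
    by (intros z Hz; now apply ex_derive_C_differentiable, Hder).
  assert (Hrad := radial_estimate f Ho).
  assert (HJ := Julia f Hd Hb Hrad).
  assert (Dp := displacement_differentiable f Hd Hb).
  assert (Rp := displacement_Re f Hb HJ).
  set (p := fun z => (cayley (f z) - cayley z)%C) in *.
  destruct (classic (p 0 = 0)) as [E|N].
  - left. exact (displacement_0_identity f Hd Hb HJ E).
  - right.
    assert (Hp0 := Rp 0 ltac:(rewrite Cmod_0; lra)).
    split; [split; [|split]|split].
    + intros z Hz Hfix. apply N. exact (fixed_point_displacement_0 f Hd Hb HJ z Hz Hfix).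
    + apply Cmod_1.
    + intros rho _ z. now apply horodisk_invariant.
    + apply iterates_converge; trivial.
      destruct (Rle_lt_or_eq_dec _ _ Hp0) as [L|L].
      * exact (orbit_of_0_drifting f Hd Hb HJ L).
      * exact (orbit_of_0_parabolic f Hd Hb HJ (eq_sym L) N).
    + destruct (Hrad (1 / 2) ltac:(lra)) as [d [Pd HD]].
      assert (Pm : 0 < Rmin d 1) by (apply Rmin_case; lra).
      assert (HA : exists c, 0 < c /\ forall r, 0 < r < 1 ->
        c <= (Re (p 0) + Cmod (p r) ^ 2) / 16).
      { destruct (Rle_lt_or_eq_dec _ _ Hp0) as [L|L].
        - exists (Re (p 0) / 16). split; [lra|]. intros r _.
          assert (X := pow2_ge_0 (Cmod (p r))). lra.
        - exists (Cmod (p 0) ^ 2 / 16). apply Cmod_gt_0 in N. split.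
          + assert (0 < Cmod (p 0) ^ 2) by now apply pow_lt. lra.
          + intros r Hr.
            rewrite (half_plane_boundary_value_constant p Dp Rp (eq_sym L) r); [lra|].
            rewrite Cmod_R, Rabs_pos_eq; lra. }
      destruct HA as [c [Pc HA]].
      apply (LimInf_filter_pos _ _ c Pc).
      exists (mkposreal _ Pm). intros r Hr Hr1.
      apply Rabs_lt_between' in Hr. simpl in Hr.
      assert (M1 := Rmin_l d 1). assert (M2 := Rmin_r d 1).
      eapply Rle_trans; [apply (HA r); lra|].
      apply (radial_displacement_bound f Hd Hb HJ); [lra|]. apply HD; lra.
Qed.
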